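(* For a fixed positive integer $k$, as $n\to\infty$, $$\operatorname{Hdepth}_1M(n,k)=\frac12n+\frac12\sqrt{(k-1)n\log n}+\frac14\sqrt{\frac{(k-1)n}{\log n}}\,\log\log n+o\!\left(\sqrt{\frac{n}{\log n}}\,\log\log n\right).$$
   Context: $K$ is a field, $R=K[X_1,\dots,X_n]$ with the standard grading ($\deg X_i=1$). $M(n,k)$ is the $k$-th syzygy module of $K=R/(X_1,\dots,X_n)$ in the Koszul complex: the image of $\partial:\bigwedge^kR^n\to\bigwedge^{k-1}R^n$, $\partial(e_{i_1}\wedge\dots\wedge e_{i_k})=\sum_{r=1}^k(-1)^{r+1}X_{i_r}e_{i_1}\wedge\dots\widehat{e_{i_r}}\dots\wedge e_{i_k}$, where $e_{i_1}\wedge\dots\wedge e_{i_k}$ has degree $k$. A graded retract of $R$ is a $K$-subalgebra generated by a set of linear forms. A Hilbert decomposition of $M$ is a finite family $(S_i,s_i)$, $s_i\in\mathbb{Z}$, $S_i$ graded retracts, with $M\cong\bigoplus_iS_i(-s_i)$ as graded $K$-vector spaces; its depth is $\min_i\dim S_i$; $\operatorname{Hdepth}_1M$ is the maximal depth of such a decomposition. $\log$ is the natural logarithm. *)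

(* Defs.v *)
From HB Require Import structures.
From mathcomp Require Import all_boot all_order all_algebra.
From mathcomp Require Import mpoly.


Set Implicit Arguments.
Unset Strict Implicit.
Unset Printing Implicit Defensive.

Import GRing.Theory.
Local Open Scope ring_scope.

Section Koszul.
Variables (K : fieldType) (n : nat).

(* R = K[X_1,...,X_n] is {mpoly K[n]} (variables 'X_i, i : 'I_n).        *)
(* Elements of /\^j R^n : coefficient functions on subsets I of 'I_n      *)
(* (the coefficient of e_I, I = {i_1 < ... < i_j}); only |I| = j matters. *)
Definition wedge := {ffun {set 'I_n} -> {mpoly K[n]}}.

Definition in_wedge (j : nat) (u : wedge) : Prop :=
  forall I : {set 'I_n}, #|I| != j -> u I = 0.

(* Koszul differential:
   d(e_{i_1}/\.../\e_{i_k}) = sum_r (-1)^(r+1) X_{i_r} e_{..^i_r..};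
   the coefficient of e_J in d u is the sum over i notin J of
   (-1)^#{j in J | j < i} X_i (coeff of e_{J u {i}} in u). *)
Definition koszul_d (u : wedge) : wedge :=
  [ffun J : {set 'I_n} =>
     \sum_(i : 'I_n | i \notin J)
        (-1) ^+ #|[set j in J | (j < i)%N]| * 'X_i * u (i |: J)].

Definition homog_int (e : int) (f : {mpoly K[n]}) : Prop :=
  match e with
  | Posz e' => f \is e'.-homog
  | Negz _ => f = 0
  end.

(* Degree-d component of M(n,k) = im (d : /\^k R^n -> /\^(k-1) R^n),
   where e_I has degree |I|: v is in M(n,k) and is homogeneous of degree d,
   i.e. each coefficient of e_J (|J| = k-1) is homogeneous of degree d-(k-1). *)
Definition M_comp (k : nat) (d : int) (v : wedge) : Prop :=
  (exists u : wedge, in_wedge k u /\ v = koszul_d u) /\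
  (forall J : {set 'I_n}, homog_int (d - (k.-1)%:Z) (v J)).

Definition linform p (A : 'M[K]_(p, n)) (i : 'I_p) : {mpoly K[n]} :=
  \sum_(j < n) A i j *: 'X_j.

Definition in_retract p (A : 'M[K]_(p, n)) (f : {mpoly K[n]}) : Prop :=
  exists q : {mpoly K[p]}, f = q \mPo [tuple linform A i | i < p].

Definition retract_comp p (A : 'M[K]_(p, n)) (e : int) (f : {mpoly K[n]}) :=
  in_retract A f /\ homog_int e f.

(* Krull dimension of the graded retract S_A: the dimension of the span
   of its generating linear forms *)
Definition retract_dim p (A : 'M[K]_(p, n)) : nat := \rank A.

Definition is_Hdecomp (k m : nat) (p : 'I_m -> nat)
    (A : forall i : 'I_m, 'M[K]_(p i, n)) (s : 'I_m -> int) : Prop :=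
  exists phi : int -> {ffun 'I_m -> {mpoly K[n]}} -> wedge,
  forall d : int,
    let D (g : {ffun 'I_m -> {mpoly K[n]}}) :=
      forall i : 'I_m, retract_comp (A i) (d - s i) (g i) in
    (forall (a : K) g h, D g -> D h ->
        phi d (a *: g + h) = a *: phi d g + phi d h) /\
    (forall g, D g -> M_comp k d (phi d g)) /\
    (forall g h, D g -> D h -> phi d g = phi d h -> g = h) /\
    (forall v, M_comp k d v -> exists2 g, D g & phi d g = v).

Definition is_Hdepth1 (k h : nat) : Prop :=
  (exists m p A s, @is_Hdecomp k m p A s /\
                   forall i : 'I_m, (h <= retract_dim (A i))%N) /\
  (forall m p A s h', @is_Hdecomp k m p A s ->
     (forall i : 'I_m, (h' <= retract_dim (A i))%N) -> (h' <= h)%N).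

End Koszul.

(* Main.v *)
Require Import Defs.
From Stdlib Require Import Reals.
From HB Require Import structures.
From mathcomp Require Import all_boot all_order all_algebra.
From mathcomp Require Import mpoly.
From mathcomp Require Import zify.
From Stdlib Require Import ClassicalEpsilon Lra.

(** The elements X^a ∂(e_I), with a supported in the variables of index at least
    min I, form a K-basis of M(n,k): the coefficient of X^(a + min I) e_(I \ min I)
    picks out X^a ∂(e_I) alone, and ∂∂ = 0 rewrites every other X^a ∂(e_I) in one
    step. Hence, with j = k - 1, the Hilbert series of M(n,k) is
    Σ_(t<n) C(t,j) T^k / (1-T)^(t+1), and since only graded dimensions matter, a
    decomposition of depth at least p exists iff (1-T)^p times this series has
    nonnegative coefficients. The coefficient of T^(k+s) is
    Σ_(t<n-p) C(p+t,j) C(s+t,t) + (-1)^s C(p,k+s), so only odd s matter. Bounding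
    C(p+t,j) between C(p,j) and C(n,j), the condition becomes, with d = s + 1 and
    up to factors bounded in terms of j,
      Π_(i<d) (p-j-i)/(n-p+i) <= C(j+d,j).
    Writing p = n/2 + x, the left side is about exp((4xd - 2d^2)/n), largest at d = x,
    so the threshold is 2x^2/n = j ln x + O(1), whose solution is the claimed
    expansion. *)

Set Implicit Arguments.
Unset Strict Implicit.
Unset Printing Implicit Defensive.

(** * Dimensions of subspaces given as predicates *)

Section Dimension.
Import GRing.Theory.
Local Open Scope ring_scope.
Variable K : fieldType.

(** The analysis turns on how p moves the two sides of the inequality. Put L = ln n, l = ln ln n and
    2p - n = sqrt(j n L) (1 + a l / L). Then the exponent (2p - n)^2 / (2n) is j (L + 2 a l) / 2 +
    O(1), while j ln(2p - n) is j (L + l) / 2 + O(1). They agree up to a constant exactly at a =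
    1/2, and moving a by c opens a gap j c l, which tends to infinity. This explains the shape of
    the error term, why replacing C(p+t,j) by C(p,j) or C(n,j) costs only a bounded term, and why
    the numerical constants can be crude. The two directions are not symmetric. Refuting a depth
    takes a single even d near (2p - n)/2. Establishing one takes every d, and for small d the
    factor C(j+d,j) is far below the power of n that it reaches at the maximum, so small and medium
    d get estimates of their own. *)

Definition lincomb (V : lmodType K) (T : finType) (b : T -> V) (c : T -> K) : V :=
  \sum_t c t *: b t.

(** Subspaces are predicates because the ambient modules, polynomial rings and [wedge], are
    infinite-dimensional. The equivalence says that [P] is exactly the span of [b], which includes
    its closure under linear combinations. *)
Definition is_basis (V : lmodType K) (P : V -> Prop) (T : finType) (b : T -> V) :=
  (forall c, lincomb b c = 0 -> forall t, c t = 0) /\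
  (forall v, P v <-> exists c, v = lincomb b c).

Definition has_dim (V : lmodType K) (P : V -> Prop) (N : nat) :=
  exists b : 'I_N -> V, is_basis P b.

Definition linear_on (V W : lmodType K) (P : V -> Prop) (f : V -> W) :=
  forall (a : K) u v, P u -> P v -> f (a *: u + v) = a *: f u + f v.

Lemma lincombP (V : lmodType K) (T : finType) (b : T -> V) a c c' :
  lincomb b (fun t => a * c t + c' t) = a *: lincomb b c + lincomb b c'.
Proof.
rewrite /lincomb scaler_sumr -big_split /=; apply: eq_bigr => t _.
by rewrite scalerDl scalerA.
Qed.

Lemma lincombB (V : lmodType K) (T : finType) (b : T -> V) c c' :
  lincomb b (fun t => c t - c' t) = lincomb b c - lincomb b c'.
Proof.
rewrite /lincomb -sumrB; apply: eq_bigr => t _; by rewrite scalerBl.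
Qed.

Lemma lincomb_delta (V : lmodType K) (T : finType) (b : T -> V) t :
  lincomb b (fun t' => (t' == t)%:R) = b t.
Proof.
rewrite /lincomb (bigD1 t) //= eqxx scale1r big1 ?addr0 // => i /negbTE ->.
by rewrite scale0r.
Qed.

Lemma is_basis_inj (V : lmodType K) (P : V -> Prop) (T : finType) (b : T -> V) c c' :
  is_basis P b -> lincomb b c = lincomb b c' -> c =1 c'.
Proof.
case=> fr _ e t; apply/eqP; rewrite -subr_eq0; apply/eqP.
by apply: (fr (fun t => c t - c' t)); rewrite lincombB e subrr.
Qed.

Lemma has_dim_basis (V : lmodType K) (P : V -> Prop) (T : finType) (b : T -> V) N :
  is_basis P b -> #|T| = N -> has_dim P N.
Proof.
move=> [fr sp] <-; exists (fun i => b (enum_val i)); split.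
  move=> c e i; rewrite -(enum_valK i).
  apply: (fr (fun t => c (enum_rank t))).
  rewrite -{}[RHS]e /lincomb (reindex_onto enum_val enum_rank) /=; last first.
    by move=> t _; rewrite enum_rankK.
  by under [LHS]eq_bigl do rewrite enum_valK eqxx; under [LHS]eq_bigr do rewrite enum_valK.
move=> v; rewrite sp; split=> -[c ->].
  exists (fun i => c (enum_val i)); rewrite /lincomb.
  rewrite (reindex_onto enum_val enum_rank) /=; last first.
    by move=> t _; rewrite enum_rankK.
  by under [LHS]eq_bigl do rewrite enum_valK eqxx.
exists (fun t => c (enum_rank t)).
rewrite /lincomb [RHS](reindex_onto enum_val enum_rank) /=; last first.
  by move=> t _; rewrite enum_rankK.
by under [RHS]eq_bigl do rewrite enum_valK eqxx; under [RHS]eq_bigr do rewrite enum_valK.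
Qed.

Lemma is_basis_lincomb (V : lmodType K) (P : V -> Prop) (T : finType) (b : T -> V) c :
  is_basis P b -> P (lincomb b c).
Proof. by case=> _ sp; apply/sp; exists c. Qed.

(** If N < N', the N' by N matrix expressing [b'] in [b] has a nonzero left kernel vector, which is
    a linear dependence of [b']. *)
Lemma has_dim_leq (V : lmodType K) (P : V -> Prop) N N' :
  has_dim P N -> has_dim P N' -> (N' <= N)%N.
Proof.
move=> [b [fr sp]] [b' [fr' sp']]; rewrite leqNgt; apply/negP => ltN.
have /fin_all_exists [M HM] (j : 'I_N') : exists c, b' j = lincomb b c.
  by apply/sp/sp'; exists (fun t' => (t' == j)%:R); rewrite lincomb_delta.
pose A : 'M[K]_(N', N) := \matrix_(j, i) M j i.
have : kermx A != 0.
  rewrite kermx_eq0 /row_free; apply/eqP => e.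
  by have := rank_leq_col A; rewrite e leqNgt ltN.
case/rowV0Pn => c /sub_kermxP cA; apply/negP; rewrite negbK.
apply/eqP/rowP => j; rewrite mxE.
apply: (fr' (fun j => c 0 j)).
transitivity (lincomb b (fun i => (c *m A) 0 i)); last first.
  by rewrite cA /lincomb big1 // => i _; rewrite mxE scale0r.
rewrite /lincomb; under [RHS]eq_bigr do rewrite mxE scaler_suml.
rewrite exchange_big /=; apply: eq_bigr => j' _.
rewrite HM /lincomb scaler_sumr; apply: eq_bigr => i _.
by rewrite mxE scalerA.
Qed.

Lemma has_dim_uniq (V : lmodType K) (P : V -> Prop) N N' :
  has_dim P N -> has_dim P N' -> N = N'.
Proof.
by move=> h h'; apply/eqP; rewrite eqn_leq (has_dim_leq h h') (has_dim_leq h' h).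
Qed.

Lemma has_dim_bij (V W : lmodType K) (P : V -> Prop) (Q : W -> Prop) f N :
  has_dim P N -> linear_on P f ->
  (forall u v, P u -> P v -> f u = f v -> u = v) ->
  (forall w, Q w <-> exists2 v, P v & w = f v) -> has_dim Q N.
Proof.
move=> [b Bb] lf fi fQ; exists (fun i => f (b i)).
have Pl c := is_basis_lincomb c Bb.
have f0 : f 0 = 0.
  have P0 : P 0 by have := Pl (fun=> 0); rewrite /lincomb big1 // => *; rewrite scale0r.
  by have := lf (-1) 0 0 P0 P0; rewrite scaler0 addr0 scaleN1r addNr.
have Pb i : P (b i) by rewrite -(lincomb_delta b i).
have lfE c : f (lincomb b c) = lincomb (fun i => f (b i)) c.
  rewrite /lincomb; suff [] : P (\sum_t c t *: b t) /\
    f (\sum_t c t *: b t) = \sum_t c t *: f (b t) by [].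
  apply: (big_rec2 (fun x y => P x /\ f x = y)) => [|i x y _ [Px <-]].
    by split => //; have := Pl (fun=> 0); rewrite /lincomb big1 // => *; rewrite scale0r.
  split; last by rewrite lf.
  case: Bb => _ /[dup] sp /(_ x) [/(_ Px) [c' ->] _].
  apply/sp; exists (fun t => c i * (t == i)%:R + c' t).
  by rewrite lincombP lincomb_delta.
split.
  move=> c; rewrite -lfE -[in RHS]f0 => /fi e.
  case: Bb => fr sp; apply: fr; apply: e => //.
  by have := Pl (fun=> 0); rewrite /lincomb big1 // => *; rewrite scale0r.
move=> w; rewrite fQ; split => [[v Pv ->]|[c ->]].
  by case: Bb => _ sp; case/sp: Pv => c ->; exists c; rewrite lfE.
by exists (lincomb b c).
Qed.

(** Coordinates in the two bases are matched. Choice makes them a function on all of [V], the shape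
    that [is_Hdecomp] asks of [phi]; outside [P] its values are arbitrary. *)
Lemma has_dim_isom (V W : lmodType K) (P : V -> Prop) (Q : W -> Prop) N :
  has_dim P N -> has_dim Q N -> exists f : V -> W,
  [/\ linear_on P f, forall v, P v -> Q (f v),
     forall u v, P u -> P v -> f u = f v -> u = v &
     forall w, Q w -> exists2 v, P v & f v = w].
Proof.
move=> [b Bb] [b' Bb'].
have /choice [c Hc] (v : V) : exists c, P v -> v = lincomb b c.
  case: (excluded_middle_informative (P v)) => [|nP]; last by exists (fun=> 0).
  by case: Bb => _ sp /sp [c ->]; exists c.
have cE v c' : v = lincomb b c' -> c v =1 c'.
  move=> e; apply: (is_basis_inj Bb); rewrite -Hc //.
  by rewrite e; apply: is_basis_lincomb.
exists (fun v => lincomb b' (c v)); split.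
- move=> a u v /Hc eu /Hc ev; rewrite -lincombP; apply: eq_bigr => i _; congr (_ *: _).
  by apply: (cE _ (fun t => a * c u t + c v t)); rewrite lincombP -eu -ev.
- by move=> v _; apply: is_basis_lincomb.
- move=> u v Pu Pv /(is_basis_inj Bb') e; rewrite (Hc u Pu) (Hc v Pv).
  by apply: eq_bigr => i _; rewrite e.
- move=> w; case: (Bb') => _ sp /sp [c' ->]; exists (lincomb b c').
    exact: is_basis_lincomb.
  by apply: eq_bigr => i _; congr (_ *: _); apply: cE.
Qed.

Lemma has_dim0 (V : lmodType K) : has_dim (fun v : V => v = 0) 0.
Proof.
exists (fun _ => 0); split; first by move=> c _ [].
move=> v; split => [->|[c ->]]; last by rewrite /lincomb big_ord0.
by exists (fun=> 0); rewrite /lincomb big_ord0.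
Qed.

Lemma has_dim_ext (V : lmodType K) (P Q : V -> Prop) N :
  (forall v, P v <-> Q v) -> has_dim P N -> has_dim Q N.
Proof.
move=> PQ [b [fr sp]]; exists b; split => // v; by rewrite -PQ.
Qed.

Lemma has_dim_ffun (V : lmodType K) (I : finType) (P : I -> V -> Prop) (N : I -> nat) :
  (forall i, has_dim (P i) (N i)) ->
  has_dim (fun g : {ffun I -> V} => forall i, P i (g i)) (\sum_i N i)%N.
Proof.
move=> /fin_all_exists [b Hb].
pose T := {i : I & 'I_(N i)}.
(* The basis of the direct sum is indexed by a summand and an index within it; [ecast] transports
   that index along the proof that the summands agree. *)
pose B (t : T) : {ffun I -> V} := [ffun j => if tag t =P j is ReflectT e
  then b j (ecast i ('I_(N i)) e (tagged t)) else 0].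
have BE (c : T -> K) j : lincomb B c j = lincomb (b j) (fun x => c (existT _ j x)).
  rewrite /lincomb sum_ffunE.
  under eq_bigr do rewrite ffunE.
  pose G i (x : 'I_(N i)) := c (existT _ i x) *: B (existT _ i x) j.
  transitivity (\sum_i \sum_(x < N i) G i x).
    rewrite sig_big_dep /=; apply: eq_bigr => -[i x] _ /=.
    by rewrite /G.
  rewrite (bigD1 j) //= [X in _ + X]big1 ?addr0 => [|i /negbTE ij].
    apply: eq_bigr => x _; rewrite /G ffunE /=; case: eqP => // e.
    by rewrite eq_axiomK.
  rewrite big1 // => x _; rewrite /G ffunE /=; case: eqP => [e|_]; last by rewrite scaler0.
  by rewrite e eqxx in ij.
apply: (@has_dim_basis _ _ T B); last first.
  rewrite card_tagged sumnE big_map big_enum /=.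
  by apply: eq_bigr => i _; rewrite card_ord.
split.
  move=> c e [i x]; case: (Hb i) => fr _.
  apply: (fr (fun x => c (existT _ i x))).
  by rewrite -BE e ffunE.
move=> g; split.
  move=> Pg.
  have /fin_all_exists [c Hc] i : exists c, g i = lincomb (b i) c.
    by case: (Hb i) => _ sp; apply/sp.
  exists (fun t => c (tag t) (tagged t)); apply/ffunP => j.
  by rewrite BE Hc.
by case=> c -> i; rewrite BE; apply: is_basis_lincomb.
Qed.

End Dimension.

(** * Monomials and Hilbert functions of polynomial rings *)

Section Monomials.
Import GRing.Theory.
Local Open Scope ring_scope.

(** The number of monomials of degree [e] in [r] variables. The truncated predecessor also serves r
    = 0: it gives 1 in degree 0 and 0 above. *)
Definition nmono (r e : nat) : nat := 'C((e + r).-1, e).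

Definition nmonoz (r : nat) (e : int) : nat :=
  if e is Posz e' then nmono r e' else 0%N.

Lemma monomials_seq n e : exists l : seq 'X_{1..n},
  [/\ uniq l, size l = nmono n e & forall m, (m \in l) = (mdeg m == e)].
Proof.
case: n => [|n].
  exists (if e == 0%N then [:: 0%MM] else [::]); split.
  - by case: eqP.
  - by case: e => [|e] //=; rewrite /nmono addn0 bin_small.
  move=> m; have -> : m = 0%MM by apply/mnmP => -[].
  by rewrite mdeg0; case: e => [|e] /=; rewrite ?inE ?in_nil ?eqxx.
exists [seq s2m t | t : e.-tuple 'I_n.+1 <- enum (basis n.+1 e)]; split.
- exact: uniq_basis.
- by rewrite size_basis /nmono addnS.
- by move=> m; rewrite -basis_cover.
Qed.

Definition supported n (B : {set 'I_n}) (m : 'X_{1..n}) :=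
  [forall i, (i \in B) || (m i == 0)%N].

Lemma supportedP n (B : {set 'I_n}) (m : 'X_{1..n}) :
  reflect (forall i, i \notin B -> m i = 0%N) (supported B m).
Proof.
apply: (iffP forallP) => h i; first by move/negbTE=> iB; have := h i; rewrite iB => /eqP.
by case: (boolP (i \in B)) => //= /h ->.
Qed.

Lemma monomials_supported_seq n (B : {set 'I_n}) e : exists l : seq 'X_{1..n},
  [/\ uniq l, size l = nmono #|B| e &
      forall m, (m \in l) = supported B m && (mdeg m == e)].
Proof.
have [l [ul sl lE]] := monomials_seq #|B| e.
pose ext (m : 'X_{1..#|B|}) : 'X_{1..n} :=
  (\sum_(i < #|B|) U_(enum_val i) *+ m i)%MM.
have extE (m : 'X_{1..#|B|}) i : ext m (enum_val i) = m i.
  rewrite /ext mnm_sumE (bigD1 i) //= mulmnE mnm1E eqxx mul1n big1 ?addn0 // => j ji.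
  by rewrite mulmnE mnm1E (inj_eq enum_val_inj) (negbTE ji).
have ext0 (m : 'X_{1..#|B|}) i : i \notin B -> ext m i = 0%N.
  move=> iB; rewrite /ext mnm_sumE big1 // => j _; rewrite mulmnE mnm1E.
  by case: eqP => // e'; rewrite -e' enum_valP in iB.
have ext_deg (m : 'X_{1..#|B|}) : mdeg (ext m) = mdeg m.
  rewrite /ext mdeg_sum [RHS]mdegE; apply: eq_bigr => i _.
  by rewrite mdegMn mdeg1 mul1n.
have exti : injective ext.
  by move=> m m' h; apply/mnmP => i; rewrite -!extE h.
exists (map ext l); split.
- by rewrite map_inj_uniq.
- by rewrite size_map.
move=> m; apply/mapP/andP.
  case=> m' ml ->; split; last by rewrite ext_deg -lE.
  by apply/supportedP => i; apply: ext0.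
case=> /supportedP sm dm.
pose r : 'X_{1..#|B|} := [multinom m (enum_val i) | i < #|B|].
have er : m = ext r.
  apply/mnmP => i; case: (boolP (i \in B)) => iB; last by rewrite sm // ext0.
  by rewrite -(enum_rankK_in iB iB) extE mnmE.
by exists r => //; rewrite lE -ext_deg -er.
Qed.

Variables (K : fieldType) (n : nat).

Lemma has_dim_monomials (l : seq 'X_{1..n}) : uniq l ->
  has_dim (fun f : {mpoly K[n]} => forall m, f@_m != 0 -> m \in l) (size l).
Proof.
move=> ul.
pose b (i : 'I_(size l)) : {mpoly K[n]} := 'X_[nth 0%MM l i].
have bE c m : (lincomb b c)@_m = \sum_(i < size l | nth 0%MM l i == m) c i.
  rewrite /lincomb raddf_sum /= [RHS]big_mkcond; apply: eq_bigr => i _.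
  by rewrite mcoeffZ mcoeffX; case: eqP; rewrite ?mulr1 ?mulr0.
have bEn c (i : 'I_(size l)) : (lincomb b c)@_(nth 0%MM l i) = c i.
  rewrite bE (big_pred1 i) // => j.
  by rewrite nth_uniq.
exists b; split.
  by move=> c e i; rewrite -bEn e mcoeff0.
move=> f; split.
  move=> fl; exists (fun i : 'I_(size l) => f@_(nth 0%MM l i)); apply/mpolyP => m.
  case: (boolP (m \in l)) => ml.
    have lm : (index m l < size l)%N by rewrite index_mem.
    by have := bEn (fun i : 'I_(size l) => f@_(nth 0%MM l i)) (Ordinal lm); rewrite /= nth_index.
  rewrite bE big1; first by apply/eqP; apply: contraNT ml; apply: fl.
  by move=> i /eqP e; rewrite -e mem_nth in ml.
case=> c -> m; rewrite bE; apply: contraNT => ml; rewrite big1 // => i /eqP e.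
by rewrite -e mem_nth in ml.
Qed.

Lemma homog_intP e (f : {mpoly K[n]}) :
  homog_int e f <-> forall m, f@_m != 0 -> (mdeg m)%:Z = e.
Proof.
case: e => e /=; split.
- by move/dhomogP => h m; rewrite -mcoeff_msupp => /h ->.
- by move=> h; apply/dhomogP => m; rewrite mcoeff_msupp => /h [].
- by move=> -> m; rewrite mcoeff0 eqxx.
- move=> h; apply/mpolyP => m; rewrite mcoeff0; apply/eqP.
  by case: (altP (f@_m =P 0)) => // /h.
Qed.

Lemma has_dim_supported (B : {set 'I_n}) (e : int) :
  has_dim (fun f : {mpoly K[n]} => homog_int e f /\
                     forall m, f@_m != 0 -> supported B m) (nmonoz #|B| e).
Proof.
case: e => e /=; last first.
  apply: has_dim_ext (has_dim0 _) => f; split => [->|[]//]; split=> // m.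
  by rewrite mcoeff0 eqxx.
have [l [ul sl lE]] := monomials_supported_seq B e.
rewrite -sl; apply: has_dim_ext (has_dim_monomials ul) => f; split.
  move=> h; split; last by move=> m /h; rewrite lE => /andP[].
  by apply/dhomogP => m; rewrite mcoeff_msupp => /h; rewrite lE => /andP[_ /eqP].
case=> /dhomogP h1 h2 m fm; rewrite lE h2 //=.
by apply/eqP/h1; rewrite mcoeff_msupp.
Qed.

Lemma has_dim_homog (e : int) :
  has_dim (@homog_int K n e) (nmonoz n e).
Proof.
rewrite -[in nmonoz _ _](card_ord n) -cardsT.
apply: has_dim_ext (has_dim_supported setT e) => f; split=> [[]//|h].
by split => // m _; apply/supportedP => i; rewrite inE.
Qed.

End Monomials.

(** * Hilbert functions of graded retracts *)

Section Retracts.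
Import GRing.Theory.
Local Open Scope ring_scope.
Variables (K : fieldType).

Lemma mpo_comp n1 n2 n3 (q : {mpoly K[n1]}) (t : n1.-tuple {mpoly K[n2]})
    (u : n2.-tuple {mpoly K[n3]}) :
  (q \mPo t) \mPo u = q \mPo [tuple (tnth t i) \mPo u | i < n1].
Proof.
rewrite [in LHS](comp_mpolyEX q t) [RHS]comp_mpolyEX rmorph_sum /=.
apply: eq_bigr => m _; rewrite linearZ /=; congr (_ *: _).
rewrite !comp_mpolyX rmorph_prod /=; apply: eq_bigr => i _.
by rewrite rmorphXn /= tnth_mktuple.
Qed.

Definition linforms p n (A : 'M[K]_(p, n)) := [tuple linform A i | i < p].

Lemma linform_mpo p n r (A : 'M[K]_(p, n)) (B : 'M[K]_(n, r)) i :
  linform A i \mPo linforms B = linform (A *m B) i.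
Proof.
rewrite /linform linear_sum /=.
transitivity (\sum_(j < n) \sum_(l < r) (A i j * B j l) *: ('X_l : {mpoly K[r]})).
  apply: eq_bigr => j _; rewrite linearZ /= comp_mpolyXU -tnth_nth tnth_mktuple.
  by rewrite scaler_sumr; apply: eq_bigr => l _; rewrite scalerA.
rewrite exchange_big; apply: eq_bigr => l _.
by rewrite mxE scaler_suml.
Qed.

Lemma linforms_mpo p n r (A : 'M[K]_(p, n)) (B : 'M[K]_(n, r)) (q : {mpoly K[p]}) :
  (q \mPo linforms A) \mPo linforms B = q \mPo linforms (A *m B).
Proof.
rewrite mpo_comp; congr (_ \mPo _); apply: eq_from_tnth => i.
by rewrite !tnth_mktuple linform_mpo.
Qed.

Lemma linforms1 n (q : {mpoly K[n]}) : q \mPo linforms 1%:M = q.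
Proof.
rewrite -[RHS]comp_mpoly_id; congr (_ \mPo _); apply: eq_from_tnth => i.
rewrite !tnth_mktuple /linform (bigD1 i) //= big1 => [|j ji].
  by rewrite mxE eqxx scale1r addr0.
by rewrite mxE eq_sym (negbTE ji) scale0r.
Qed.

Lemma linforms_homog p n (A : 'M[K]_(p, n)) e (q : {mpoly K[p]}) :
  homog_int e q -> homog_int e (q \mPo linforms A).
Proof.
case: e => e /=; last by move=> ->; rewrite comp_mpoly0.
move=> /dhomogP hq; rewrite comp_mpolyEX big_seq rpred_sum // => m mq.
apply: rpredZ; rewrite comp_mpolyX.
have -> : e = (\sum_(i < p) m i)%N by rewrite -mdegE; apply/esym/hq.
have hl i : linform A i \is 1.-homog.
  by apply: rpred_sum => j _; apply: rpredZ; rewrite dhomogX; apply/eqP/mdeg1.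
have aux (s : seq 'I_p) : \prod_(i <- s) tnth (linforms A) i ^+ m i
    \is (\sum_(i <- s) m i).-homog.
  elim: s => [|i s IH]; first by rewrite !big_nil dhomog1.
  rewrite !big_cons dhomogM // -[X in X.-homog]mul1n dhomogMn //.
  by rewrite tnth_mktuple.
exact: aux.
Qed.

Lemma in_retract_row_base p n (A : 'M[K]_(p, n)) f :
  in_retract A f <-> in_retract (row_base A) f.
Proof.
split=> -[q ->].
  by exists (q \mPo linforms (col_base A)); rewrite linforms_mpo mulmx_base.
have /submxP [D ->] : (row_base A <= A)%MS by rewrite eq_row_base.
by exists (q \mPo linforms D); rewrite linforms_mpo.
Qed.

(** A row basis makes the linear forms independent. Substituting them then has a left inverse, the
    substitution given by a right inverse matrix, and both preserve degrees; so the retract is a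
    polynomial ring in [\rank A] variables. *)
Lemma has_dim_retract p n (A : 'M[K]_(p, n)) (e : int) :
  has_dim (retract_comp A e) (nmonoz (retract_dim A) e).
Proof.
set B := row_base A; pose C := pinvmx B.
have BC : B *m C = 1%:M by apply: mulmxVp; apply: row_base_free.
have BK (q : {mpoly K[\rank A]}) : (q \mPo linforms B) \mPo linforms C = q.
  by rewrite linforms_mpo BC linforms1.
apply: (has_dim_bij (f := fun q => q \mPo linforms B) (has_dim_homog K (\rank A) e)).
- by move=> a u v _ _; rewrite linearP.
- by move=> u v _ _ h; rewrite -(BK u) h BK.
move=> f; split.
  case=> /in_retract_row_base [q ->] hq; exists q => //.
  by rewrite -(BK q); apply: linforms_homog.
case=> q hq ->; split; last exact: linforms_homog.
by apply/in_retract_row_base; exists q.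
Qed.

End Retracts.

(** * The monomial basis of the Koszul syzygies *)

Section KoszulSyzygies.
Import GRing.Theory.
Local Open Scope ring_scope.
Variables (K : fieldType) (n : nat).
Implicit Types (u v w : wedge K n) (I J : {set 'I_n}) (a m : 'X_{1..n}).

Lemma koszul_d_is_linear : linear (@koszul_d K n).
Proof.
move=> c u v; apply/ffunP => J; rewrite !ffunE scaler_sumr -big_split /=.
apply: eq_bigr => i _; rewrite !ffunE mulrDr; congr (_ + _).
by rewrite scalerAr.
Qed.

HB.instance Definition _ := GRing.isLinear.Build K (wedge K n) (wedge K n) _
  (@koszul_d K n) koszul_d_is_linear.

Lemma sum_antisymmetric (V : zmodType) (F : 'I_n -> 'I_n -> V) :
  (forall i j : 'I_n, (i < j)%N -> F j i = - F i j) -> (forall i, F i i = 0) ->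
  \sum_i \sum_j F i j = 0.
Proof.
move=> FN F0.
have -> : \sum_i \sum_j F i j =
    \sum_(i < n) \sum_(j < n | (i < j)%N) F i j +
    \sum_(i < n) \sum_(j < n | (j < i)%N) F i j.
  rewrite -big_split; apply: eq_bigr => i _ /=.
  rewrite (bigID (fun j : 'I_n => (i < j)%N)) /=; congr (_ + _).
  rewrite (bigD1 i) ?ltnn //= F0 add0r; apply: eq_bigl => j.
  by rewrite -leqNgt ltn_neqAle andbC.
rewrite [X in _ + X](exchange_big_dep predT) //= -big_split big1 //= => i _.
rewrite -big_split big1 //= => j ij.
by rewrite (FN i j) // subrr.
Qed.

Definition ksign (i : 'I_n) J : {mpoly K[n]} := (-1) ^+ #|[set j in J | (j < i)%N]|.

(** Inserting the larger index does not change the number of elements below the smaller one, while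
    inserting the smaller index adds one element below the larger. *)
Lemma ksign_swap i i' J : i \notin J -> i' \notin J -> (i < i')%N ->
  ksign i' J * ksign i (i' |: J) = - (ksign i J * ksign i' (i |: J)).
Proof.
move=> iJ i'J ii'; rewrite /ksign.
have -> : [set j in i' |: J | (j < i)%N] = [set j in J | (j < i)%N].
  apply/setP => j; rewrite !inE; case: eqP => //= ->.
  by rewrite ltnNge (ltnW ii') andbF.
have -> : [set j in i |: J | (j < i')%N] = i |: [set j in J | (j < i')%N].
  apply/setP => j; rewrite !inE; case: eqP => //= ->.
  by rewrite ii'.
rewrite cardsU1 inE (negbTE iJ) /= add1n exprS mulN1r mulrN opprK.
exact: mulrC.
Qed.

Lemma koszul_dd u : koszul_d (koszul_d u) = 0.
Proof.
apply/ffunP => J; rewrite !ffunE.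
pose F i i' := if [&& i \notin J, i' \notin J & i != i'] then
  (ksign i J * ksign i' (i |: J)) * ('X_i * 'X_i') * u (i' |: (i |: J)) else 0.
transitivity (\sum_i \sum_i' F i i').
  rewrite big_mkcond; apply: eq_bigr => i _; rewrite ffunE.
  case: ifP => [iJ|iJ]; last by rewrite big1 // => j _; rewrite /F iJ.
  rewrite mulr_sumr big_mkcond; apply: eq_bigr => i' _.
  rewrite /F iJ /= !inE negb_or eq_sym andbC; case: ifP => // _.
  by rewrite -/(ksign i J) -/(ksign i' (i |: J)) !mulrA; congr (_ * _ * _); rewrite mulrAC.
apply: sum_antisymmetric => [i j ij|i]; last by rewrite /F eqxx !andbF.
rewrite /F eq_sym andbCA; case: ifP => [/and3P[jJ iJ _]|]; last by rewrite oppr0.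
by rewrite ksign_swap // !mulNr ['X_j * _]mulrC setUCA.
Qed.

Definition upset I : {set 'I_n} := [set i : 'I_n | [exists j in I, (j <= i)%N]].

Lemma upsetP I (i : 'I_n) : reflect (exists2 j, j \in I & (j <= i)%N) (i \in upset I).
Proof. by rewrite inE; apply: (iffP exists_inP). Qed.

(* Spanned by the X^a e_I with a supported in the variables of index >= min I. *)
Definition standard k u := forall I m, (u I)@_m != 0 -> #|I| = k /\ supported (upset I) m.

Definition single I (f : {mpoly K[n]}) : wedge K n := [ffun J => if J == I then f else 0].

Lemma mcoeff_sign N (f : {mpoly K[n]}) m : ((-1) ^+ N * f)@_m = (-1) ^+ N * f@_m.
Proof.
have -> : (-1) ^+ N = ((-1) ^+ N)%:MP :> {mpoly K[n]}.
  by rewrite rmorphXn rmorphN1.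
by rewrite mcoeffCM.
Qed.

Lemma mcoeff_ksign i J (f : {mpoly K[n]}) m :
  ((ksign i J * f)@_m != 0) = (f@_m != 0).
Proof. by rewrite mcoeff_sign mulf_eq0 signr_eq0. Qed.

Lemma mcoeff_mulXU (i : 'I_n) (f : {mpoly K[n]}) m :
  ('X_i * f)@_m = if m i == 0%N then 0 else f@_(m - U_(i)).
Proof.
case: eqP => mi; last first.
  have {1}-> : m = (U_(i) + (m - U_(i)))%MM.
    rewrite addmC submK //; apply/mnm_lepP => j; rewrite mnm1E.
    by case: eqP => // <-; rewrite lt0n; apply/eqP.
  by rewrite mulrC mcoeffMX.
apply/eqP; rewrite mcoeff_eq0 mulrC (perm_mem (msuppMX f U_(i))).
by apply/negP => /mapP[m' _ e]; move: mi; rewrite e mnmDE mnm1E eqxx.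
Qed.

(** Any other contribution comes from an i' outside I, through the monomial X^(a + i - i') on
    [i' |: (I :\ i)]. If i < i', this monomial contains X_i although all indices of that set exceed
    i, so it is not standard. If i' < i, then X_i' would divide X^a, whose variables have index at
    least i. *)
Lemma koszul_d_standard_coeff k u I i a : standard k u ->
  i \in I -> (forall j, j \in I -> (i <= j)%N) -> supported (upset I) a ->
  (koszul_d u (I :\ i))@_(a + U_(i)) = (u I)@_a.
Proof.
move=> su iI mini /supportedP sa.
have s1 : ksign i (I :\ i) = 1.
  rewrite /ksign (_ : [set _ in _ | _] = set0) ?cards0 //.
  apply/setP => j; rewrite !inE; apply/negP => /andP[/andP[_ /mini]].
  by rewrite leqNgt => /negbTE ->.
rewrite ffunE raddf_sum /= (bigD1 i) /=; last by rewrite !inE eqxx.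
rewrite -/(ksign i (I :\ i)) s1 mul1r setD1K // mcoeff_mulXU mnmDE mnm1E eqxx addn1 /=.
rewrite addmK big1 ?addr0 // => i' /andP[i'I i'i].
rewrite -mulrA; apply/eqP; case: eqP => // /eqP.
rewrite mcoeff_ksign mcoeff_mulXU; case: ifP => [|/eqP ai']; first by rewrite eqxx.
move=> /su [_ /supportedP sm].
case: (ltngtP i i') => [ii'|i'lt|e]; last by rewrite (val_inj e) eqxx in i'i.
  have := sm i; rewrite mnmBE mnmDE !mnm1E eqxx (negbTE i'i) subn0 addn1 => h.
  suff : i \notin upset (i' |: (I :\ i)) by move/h.
  apply/upsetP => -[j]; rewrite !inE => /orP[/eqP ->|/andP[ji jI]] le.
    by rewrite leqNgt ii' in le.
  by case/eqP: ji; apply: val_inj; apply/eqP; rewrite eqn_leq le mini.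
case: ai'; rewrite mnmDE mnm1E [i == i']eq_sym (negbTE i'i) addn0.
apply: sa; apply/upsetP => -[j /mini]; lia.
Qed.

Lemma set_min I : I != set0 ->
  exists2 i, i \in I & forall j, j \in I -> (i <= j)%N.
Proof.
case/set0Pn => i0 i0I; case: (@arg_minnP _ i0 (mem I) val i0I) => i iI h.
by exists i.
Qed.

Lemma koszul_d_standard_inj k u v : (0 < k)%N -> standard k u -> standard k v ->
  koszul_d u = koszul_d v -> u = v.
Proof.
move=> k0 su sv uv; apply/ffunP => I; apply/mpolyP => m.
have key : #|I| = k -> supported (upset I) m -> (u I)@_m = (v I)@_m.
  move=> cI sm; have [|i iI mini] := @set_min I; first by rewrite -card_gt0 cI.
  by rewrite -(koszul_d_standard_coeff su iI) // -(koszul_d_standard_coeff sv iI) // uv.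
case: (altP ((u I)@_m =P 0)) => [u0|/su [cI sm]]; last exact: key.
case: (altP ((v I)@_m =P 0)) => [-> //|/sv [cI sm]]; exact: key.
Qed.

Lemma standard_lin k c u v : standard k u -> standard k v -> standard k (c *: u + v).
Proof.
move=> su sv I m; rewrite !ffunE mcoeffD mcoeffZ.
case: (altP ((u I)@_m =P 0)) => [->|/su //]; rewrite mulr0 add0r; exact: sv.
Qed.

(* If the least variable X_j of X^a precedes I, then subtracting the boundary of
   X^(a-j) e_(I u j) rewrites X^a e_I in terms of standard elements. *)
Lemma standardize_single k I a : #|I| = k ->
  exists2 u, standard k u & koszul_d u = koszul_d (single I 'X_[a]).
Proof.
move=> cI; case: (boolP (supported (upset I) a)) => [sa|].
  exists (single I 'X_[a]) => // J m; rewrite ffunE.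
  case: (J =P I) => [->|_]; last by rewrite mcoeff0 eqxx.
  by rewrite mcoeffX; case: (a =P m) => [<-|]; rewrite ?eqxx.
case/forallPn => i0; rewrite negb_or => /andP[i0I a0].
case: (@arg_minnP _ i0 (fun i => a i != 0%N) val a0) => j aj minj.
have jI i : i \in I -> (j < i)%N.
  move=> iI; rewrite ltnNge; apply/negP => ij; case/upsetP: i0I; exists i => //.
  exact: leq_trans ij (minj _ a0).
have jnI : j \notin I by apply/negP => /jI; rewrite ltnn.
pose w := single (j |: I) 'X_[a - U_(j)].
exists (single I 'X_[a] - koszul_d w); last first.
  by rewrite linearB /= koszul_dd subr0.
move=> J m; rewrite !ffunE; case: (J =P I) => [->|JI].
  have -> : \sum_(i | i \notin I) (-1) ^+ #|[set j0 in I | (j0 < i)%N]| * 'X_i * w (i |: I)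
     = 'X_[a].
    rewrite (bigD1 j) //= [X in _ + X]big1 => [|i /andP[iI ij]].
      rewrite addr0 ffunE eqxx (_ : [set _ in _ | _] = set0) ?cards0 ?expr0 ?mul1r.
        rewrite -mpolyXD addmC submK //; apply/mnm_lepP => l; rewrite mnm1E.
        by case: eqP => // <-; rewrite lt0n.
      apply/setP => i; rewrite !inE; apply/negP => /andP[/jI h1 h2].
      by rewrite ltnNge (ltnW h1) in h2.
    rewrite ffunE; case: eqP => [e|]; last by rewrite mulr0.
    have : i \in j |: I by rewrite -e !inE eqxx.
    by rewrite !inE (negbTE ij) (negbTE iI).
  by rewrite subrr mcoeff0 eqxx.
rewrite sub0r mcoeffN oppr_eq0 raddf_sum /= => nz.
have [i /andP[iJ]] : exists i, (i \notin J) &&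
   (((-1) ^+ #|[set j0 in J | (j0 < i)%N]| * 'X_i * w (i |: J))@_m != 0).
  apply/existsP; apply: contraNT nz; rewrite negb_exists => /forallP h.
  rewrite big1 // => i iJ; have := h i; rewrite iJ /= negbK => /eqP.
  by [].
rewrite -mulrA -/(ksign i J) mcoeff_ksign ffunE; case: (i |: J =P j |: I) => [e|]; last first.
  by rewrite mulr0 mcoeff0 eqxx.
rewrite mcoeff_mulXU; case: ifP => [|/eqP mi]; first by rewrite eqxx.
rewrite mcoeffX; case: ((a - U_(j))%MM =P (m - U_(i))%MM) => [em _|]; last by rewrite eqxx.
have iIj : i \in j |: I by rewrite -e !inE eqxx.
have ij : i != j.
  apply/eqP => ij; apply: JI; rewrite -(setU1K iJ) -(setU1K jnI) e ij //.
have jJ : j \in J.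
  have : j \in i |: J by rewrite e !inE eqxx.
  by rewrite !inE eq_sym (negbTE ij).
have cJ : #|J| = k.
  have := cardsU1 i J; rewrite e iJ cardsU1 jnI cI /= => h; lia.
split => //; apply/supportedP => l lJ.
have lj : (l < j)%N by rewrite ltnNge; apply/negP => jl; case/upsetP: lJ; exists j.
have il : i != l.
  apply/eqP => il; move: iIj; rewrite !inE (negbTE ij) /= => /jI.
  by rewrite il ltnNge (ltnW lj).
have := congr1 (fun m : 'X_{1..n} => m l) em.
rewrite !mnmBE !mnm1E (negbTE il) subn0 => <-.
have -> : a l = 0%N; last by rewrite sub0n.
by apply/eqP; apply: contraTT lj => /minj; rewrite -leqNgt.
Qed.

Lemma standardize k u : in_wedge k u ->
  exists2 u', standard k u' & koszul_d u' = koszul_d u.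
Proof.
move=> wu.
have -> : u = \sum_(I : {set 'I_n} | #|I| == k) \sum_(m <- msupp (u I))
    (u I)@_m *: single I 'X_[m].
  apply/ffunP => J; rewrite sum_ffunE.
  case: (boolP (#|J| == k)) => cJ; last first.
    rewrite (wu _ cJ) big1 // => I cI; rewrite sum_ffunE big1 // => m _.
    by rewrite !ffunE; case: eqP => [e|]; [rewrite -e (negbTE cJ) in cI|rewrite scaler0].
  rewrite (bigD1 J) //= [X in _ + X]big1 ?addr0 => [|I /andP[_ IJ]]; rewrite sum_ffunE.
    by rewrite {1}[u J]mpolyE; apply: eq_bigr => m _; rewrite !ffunE eqxx.
  by rewrite big1 // => m _; rewrite !ffunE eq_sym (negbTE IJ) scaler0.
pose Q v := exists2 u', standard k u' & koszul_d u' = koszul_d v.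
have Q0 : Q 0 by exists 0 => // I m; rewrite ffunE mcoeff0 eqxx.
have QD v v' : Q v -> Q v' -> Q (v + v').
  move=> [a sa ea] [b sb eb]; exists (1 *: a + b); first exact: standard_lin.
  by rewrite scale1r !linearD /= ea eb.
apply: (big_ind Q) => // I /eqP cI; apply: (big_ind Q) => // m _.
have [a sa ea] := standardize_single m cI.
exists ((u I)@_m *: a + 0).
  by apply: standard_lin => // J m'; rewrite ffunE mcoeff0 eqxx.
by rewrite addr0 !linearZ /= ea.
Qed.

(** A standard preimage of a homogeneous element is homogeneous: each of its coefficients reappears
    in the boundary, one degree higher, by [koszul_d_standard_coeff]. *)
Lemma M_comp_standard k d v : (0 < k)%N ->
  M_comp k d v <-> exists2 u, (standard k u /\ forall I, homog_int (d - k%:Z) (u I)) &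
                              v = koszul_d u.
Proof.
move=> k0; split.
  case=> -[u0 [/standardize [u su <-] ->]] hv; exists u => //; split=> // I.
  apply/homog_intP => m um; have [cI sm] := su _ _ um.
  have [|i iI mini] := @set_min I; first by rewrite -card_gt0 cI.
  move: um; rewrite -(koszul_d_standard_coeff su iI mini sm).
  move/homog_intP: (hv (I :\ i)) => h /h; rewrite mdegD mdeg1; lia.
case=> u [su hu] ->; split.
  exists u; split => // I cI; apply/mpolyP => m; rewrite mcoeff0; apply/eqP.
  by apply: contraNT cI => /su [->].
move=> J; apply/homog_intP => m; rewrite ffunE raddf_sum /= => nz.
have [i /andP[iJ]] : exists i, (i \notin J) &&
   (((-1) ^+ #|[set j0 in J | (j0 < i)%N]| * 'X_i * u (i |: J))@_m != 0).
  apply/existsP; apply: contraNT nz; rewrite negb_exists => /forallP h.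
  rewrite big1 // => i iJ; have := h i; rewrite iJ /= negbK => /eqP.
  by [].
rewrite -mulrA -/(ksign i J) mcoeff_ksign mcoeff_mulXU; case: ifP => [|/eqP mi]; first by rewrite eqxx.
move/homog_intP: (hu (i |: J)) => h /h.
have mE : m = (m - U_(i) + U_(i))%MM.
  rewrite submK //; apply/mnm_lepP => j; rewrite mnm1E.
  by case: eqP => // <-; rewrite lt0n; apply/eqP.
by rewrite {2}mE mdegD mdeg1; lia.
Qed.

(** Each k-subset I contributes a polynomial ring in the variables of [upset I], generated in degree
    k. *)
Definition hilbM k (d : int) : nat :=
  \sum_(I : {set 'I_n} | #|I| == k) nmonoz #|upset I| (d - k%:Z).

Lemma has_dim_M k d : (0 < k)%N -> has_dim (@M_comp K n k d) (hilbM k d).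
Proof.
move=> k0.
pose P I (f : {mpoly K[n]}) := if #|I| == k then homog_int (d - k%:Z) f /\
   (forall m, f@_m != 0 -> supported (upset I) m) else f = 0.
have hP I : has_dim (P I) (if #|I| == k then nmonoz #|upset I| (d - k%:Z) else 0%N).
  by rewrite /P; case: eqP => _; [apply: has_dim_supported|apply: has_dim0].
rewrite /hilbM big_mkcond.
have PE u : (forall I, P I (u I)) <->
    (standard k u /\ forall I, homog_int (d - k%:Z) (u I)).
  split => [hu|[su hu] I].
    split=> [I m|I]; have := hu I; rewrite /P; case: eqP => // cI.
    - by case=> _ h /h.
    - by move=> ->; rewrite mcoeff0 eqxx.
    - by case.
    - by move=> ->; apply/homog_intP => m; rewrite mcoeff0 eqxx.
  rewrite /P; case: eqP => cI; first by split=> // m /su [].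
  apply/mpolyP => m; rewrite mcoeff0; case: (altP ((u I)@_m =P 0)) => // /su [].
  by move/cI.
apply: (has_dim_bij (f := @koszul_d K n) (has_dim_ffun hP)).
- by move=> a u v _ _; rewrite linearP.
- by move=> u v /PE [su _] /PE [sv _]; apply: (koszul_d_standard_inj k0 su sv).
move=> v; rewrite (M_comp_standard _ _ k0); split=> -[u hu ->]; exists u => //; exact/PE.
Qed.

(** The graded pieces are finite-dimensional and [phi] is constrained one degree at a time, so only
    their dimensions count. *)
Lemma is_HdecompE k (m : nat) (p : 'I_m -> nat) (A : forall i, 'M[K]_(p i, n)) (s : 'I_m -> int) :
  (0 < k)%N ->
  is_Hdecomp k A s <->
  forall d, hilbM k d = (\sum_i nmonoz (retract_dim (A i)) (d - s i))%N.
Proof.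
move=> k0.
pose D (d : int) (g : {ffun 'I_m -> {mpoly K[n]}}) :=
  forall i : 'I_m, retract_comp (A i) (d - s i) (g i).
have hD d : has_dim (D d) (\sum_i nmonoz (retract_dim (A i)) (d - s i))%N.
  apply: (has_dim_ffun (P := fun i => retract_comp (A i) (d - s i))) => i.
  exact: has_dim_retract.
split.
  case=> phi hphi d; have [lphi [phiM [phi_inj phi_surj]]] := hphi d.
  apply: has_dim_uniq (has_dim_M d k0) _.
  apply: (has_dim_bij (hD d) lphi phi_inj) => w; split.
    by case/phi_surj => g Dg <-; exists g.
  by case=> g Dg ->; apply: phiM.
move=> h.
have /choice [phi hphi] d : exists phi : {ffun 'I_m -> {mpoly K[n]}} -> wedge K n,
  [/\ linear_on (D d) phi, forall g, D d g -> M_comp k d (phi g),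
     forall g g', D d g -> D d g' -> phi g = phi g' -> g = g' &
     forall w, M_comp k d w -> exists2 g, D d g & phi g = w].
  have := has_dim_M d k0; rewrite h; exact: has_dim_isom (hD d).
by exists phi => d; have [h1 h2 h3 h4] := hphi d.
Qed.

End KoszulSyzygies.

(** * The Hilbert function as a sum over minima *)

Section HilbertFunction.
Local Open Scope nat_scope.

Lemma card_ord_geq n i : #|[set j : 'I_n | i <= j]| = n - i.
Proof.
rewrite -sum1dep_card -(big_mkord (fun j => i <= j) (fun=> 1)).
case: (leqP i n) => lein.
  rewrite (big_cat_nat _ (n := i)) //= big_nat_cond big_pred0 ?add0n => [|j].
    rewrite big_nat_cond (eq_bigl (fun j => (i <= j < n) && true)) => [|j].
      by rewrite -big_nat_cond sum_nat_const_nat muln1.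
    by case: (i <= j); rewrite ?andbF ?andbT.
  by apply/negbTE; lia.
rewrite big_nat_cond big_pred0 => [|j]; lia.
Qed.

Definition is_min n (i : 'I_n) (I : {set 'I_n}) :=
  (i \in I) && [forall j in I, i <= j].

Lemma card_upset n (i : 'I_n) I : is_min i I -> #|upset I| = n - i.
Proof.
case/andP=> iI /forall_inP h; rewrite -card_ord_geq; apply: eq_card => l.
rewrite [RHS]inE; apply/upsetP/idP => [[j /h]|il]; [exact: leq_trans|by exists i].
Qed.

Lemma card_is_min n (i : 'I_n) k :
  #|[set I : {set 'I_n} | (#|I| == k.+1) && is_min i I]| = 'C(n - i.+1, k).
Proof.
rewrite -card_ord_geq -cards_draws.
rewrite -(@card_in_imset _ _ (fun J => i |: J)); last first.
  move=> J J'; rewrite !inE => /andP[/subsetP sJ _] /andP[/subsetP sJ' _] e.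
  have ni (L : {set 'I_n}) : {subset L <= [set j : 'I_n | i < j]} -> i \notin L.
    by move=> h; apply/negP => /h; rewrite inE ltnn.
  by rewrite -(setU1K (ni _ sJ)) e setU1K // ni.
apply: eq_card => I; rewrite inE; apply/idP/imsetP.
  case/and3P=> /eqP cI iI /forall_inP h; exists (I :\ i); last by rewrite setD1K.
  rewrite inE; apply/andP; split.
    apply/subsetP => j; rewrite !inE => /andP[ji /h].
    by rewrite leq_eqVlt => /orP[/eqP/val_inj e|//]; rewrite e eqxx in ji.
  by have := cardsD1 i I; rewrite iI cI => -[->].
case=> J; rewrite inE => /andP[/subsetP sJ /eqP cJ] ->.
have iJ : i \notin J by apply/negP => /sJ; rewrite inE ltnn.
rewrite cardsU1 iJ cJ /= eqxx /is_min !inE eqxx /=.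
apply/forall_inP => j; rewrite !inE => /orP[/eqP -> //|/sJ].
by rewrite inE; apply: ltnW.
Qed.

(** Subsets are grouped by their minimum i: C(n - 1 - i, k) of them share an [upset] of size n - i.
    The index t is n - 1 - i. *)
Lemma sum_card_upset n k (F : nat -> nat) :
  \sum_(I : {set 'I_n} | #|I| == k.+1) F #|upset I| = \sum_(t < n) 'C(t, k) * F t.+1.
Proof.
transitivity (\sum_(I : {set 'I_n} | #|I| == k.+1) \sum_(i < n | is_min i I) F (n - i)).
  apply: eq_bigr => I /eqP cI.
  have [|i iI mini] := @set_min _ I; first by rewrite -card_gt0 cI.
  have im : is_min i I by rewrite /is_min iI /=; apply/forall_inP.
  rewrite (card_upset im) (big_pred1 i) // => j; apply/idP/eqP => [|-> //].
  case/andP => jI /forall_inP hj; apply: val_inj; apply/eqP.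
  by rewrite eqn_leq mini // hj.
rewrite (exchange_big_dep predT) //= (reindex_inj rev_ord_inj) /=.
apply: eq_bigr => t _; rewrite sum_nat_const.
have -> : n - (n - t.+1) = t.+1 by have := ltn_ord t; lia.
congr (_ * _); have := card_is_min (rev_ord t) k; rewrite cardsE /= => ->.
by congr 'C(_, _); have := ltn_ord t; lia.
Qed.

Lemma hilbME n k d :
  hilbM n k.+1 d = \sum_(t < n) 'C(t, k) * nmonoz t.+1 (d - k.+1%:Z).
Proof. by rewrite /hilbM (sum_card_upset _ _ (fun r => nmonoz r (d - k.+1%:Z))). Qed.

End HilbertFunction.

(** * Power series as coefficient sequences, and sums of poles *)

Section PartialSums.
Import GRing.Theory Num.Theory Order.TTheory.
Local Open Scope ring_scope.
Implicit Types f g : nat -> int.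

(** Multiplication by 1 / (1 - T). Multiplication by (1 - T)^p is always handled through its inverse
    [iter p psum], which is injective and preserves nonnegativity. *)
Definition psum f (d : nat) : int := \sum_(i < d.+1) f i.

Lemma psum0 f : psum f 0 = f 0%N. Proof. by rewrite /psum big_ord1. Qed.

Lemma psumS f d : psum f d.+1 = psum f d + f d.+1.
Proof. by rewrite /psum big_ord_recr. Qed.

Lemma eq_psum f g : f =1 g -> psum f =1 psum g.
Proof. by move=> fg d; apply: eq_bigr. Qed.

Lemma psumP f g : g 0%N = f 0%N -> (forall d, g d.+1 = g d + f d.+1) -> psum f =1 g.
Proof.
move=> g0 gS; elim=> [|d IH]; first by rewrite psum0 g0.
by rewrite psumS IH gS.
Qed.

Lemma psum_inj f g : psum f =1 psum g -> f =1 g.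
Proof.
move=> h [|d]; first by have := h 0%N; rewrite !psum0.
by have := h d.+1; rewrite !psumS h => /addrI.
Qed.

Lemma eq_iter_psum p f g : f =1 g -> iter p psum f =1 iter p psum g.
Proof. by move=> fg; elim: p => //= p IH; apply: eq_psum. Qed.

Lemma iter_psum_inj p f g : iter p psum f =1 iter p psum g -> f =1 g.
Proof. by elim: p => //= p IH /psum_inj. Qed.

Lemma psum_ge0 f : (forall d, 0 <= f d) -> forall d, 0 <= psum f d.
Proof. by move=> h d; apply: sumr_ge0. Qed.

Lemma psum_sum (T : Type) (l : seq T) (F : T -> nat -> int) d :
  psum (fun d => \sum_(x <- l) F x d) d = \sum_(x <- l) psum (F x) d.
Proof. by rewrite /psum exchange_big. Qed.

Lemma iter_psum_sum (T : Type) p (l : seq T) (F : T -> nat -> int) :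
  iter p psum (fun d => \sum_(x <- l) F x d) =1
  fun d => \sum_(x <- l) iter p psum (F x) d.
Proof.
by elim: p => //= p IH d; rewrite (eq_psum IH) psum_sum.
Qed.

(* The coefficients of T^s / (1-T)^r. *)
Definition pole (r s d : nat) : int := (nmonoz r (d%:Z - s%:Z))%:Z.

Lemma pole_ge r s d : (s <= d)%N -> pole r s d = (nmono r (d - s))%:Z.
Proof. by move=> sd; rewrite /pole subzn. Qed.

Lemma pole_lt r s d : (d < s)%N -> pole r s d = 0.
Proof.
move=> ds; rewrite /pole; case E: (d%:Z - s%:Z) => [a|//]; lia.
Qed.

Lemma pole_ge0 r s d : 0 <= pole r s d. Proof. by []. Qed.

Lemma nmonor0 r : nmono r 0 = 1%N. Proof. by rewrite /nmono bin0. Qed.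

Lemma nmono0S e : nmono 0 e.+1 = 0%N. Proof. by rewrite /nmono bin_small ?addn0. Qed.

Lemma nmonoSS r e : nmono r.+1 e.+1 = (nmono r.+1 e + nmono r e.+1)%N.
Proof. by rewrite /nmono !addnS !addSn /= binS addnC. Qed.

Lemma psum_pole r s : psum (pole r s) =1 pole r.+1 s.
Proof.
apply: psumP => [|d].
  by case: s => [|s]; [rewrite !pole_ge // !nmonor0|rewrite !pole_lt].
case: (ltngtP d.+1 s) => ds; first by rewrite !pole_lt ?addr0 //; lia.
  by rewrite !pole_ge ?subSn ?nmonoSS ?PoszD // ltnW.
by rewrite ds [pole r.+1 s d]pole_lt -?ds // !pole_ge // subnn !nmonor0.
Qed.

Lemma iter_psum_pole p r s : iter p psum (pole r s) =1 pole (p + r) s.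
Proof.
elim: p => //= p IH d; by rewrite (eq_psum IH) psum_pole.
Qed.

Lemma pole0 s d : pole 0 s d = (d == s)%:R.
Proof.
case: (ltngtP d s) => [ds|ds|->]; first by rewrite pole_lt.
  by rewrite pole_ge ?(ltnW ds) // -[(d - s)%N]prednK ?subn_gt0 // nmono0S.
by rewrite pole_ge // subnn nmonor0.
Qed.

Lemma pole1 s d : pole 1 s d = (s <= d)%:R.
Proof.
case: leqP => [sd|ds]; last by rewrite pole_lt.
by rewrite pole_ge // /nmono addn1 binn.
Qed.

(** These are the Hilbert series of finite families of shifted polynomial rings with dimensions
    between [lo] and [hi]. *)
Definition polar lo hi f := exists2 l : seq (nat * nat),
  all (fun x => lo <= x.1 <= hi)%N l & f =1 fun d => \sum_(x <- l) pole x.1 x.2 d.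

Lemma polar_ext lo hi f g : f =1 g -> polar lo hi f -> polar lo hi g.
Proof. by move=> fg [l al fE]; exists l => // d; rewrite -fg. Qed.

Lemma polar_weak lo hi lo' hi' f : (lo' <= lo)%N -> (hi <= hi')%N ->
  polar lo hi f -> polar lo' hi' f.
Proof.
move=> h1 h2 [l al fE]; exists l => //; apply: sub_all al => x /andP[h3 h4].
by rewrite (leq_trans h1 h3) (leq_trans h4 h2).
Qed.

Lemma polar0 lo hi : polar lo hi (fun=> 0).
Proof. by exists [::] => // d; rewrite big_nil. Qed.

Lemma polarD lo hi f g : polar lo hi f -> polar lo hi g -> polar lo hi (fun d => f d + g d).
Proof.
move=> [l al fE] [l' al' gE]; exists (l ++ l'); first by rewrite all_cat al al'.
by move=> d; rewrite big_cat fE gE.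
Qed.

Lemma polar_sum lo hi (T : eqType) (l : seq T) (F : T -> nat -> int) :
  {in l, forall x, polar lo hi (F x)} -> polar lo hi (fun d => \sum_(x <- l) F x d).
Proof.
elim: l => [|x l IH] h; first by apply: polar_ext (polar0 lo hi) => d; rewrite big_nil.
apply: (@polar_ext _ _ (fun d => F x d + \sum_(y <- l) F y d)).
  by move=> d; rewrite big_cons.
apply: polarD; first by apply: h; rewrite inE eqxx.
by apply: IH => y yl; apply: h; rewrite inE yl orbT.
Qed.

Lemma polarM lo hi c f : 0 <= c -> polar lo hi f -> polar lo hi (fun d => c * f d).
Proof.
case: c => // c _ hf; elim: c => [|c IH].
  by apply: polar_ext (polar0 _ _) => d; rewrite mul0r.
by apply: polar_ext (polarD IH hf) => d; rewrite -addn1 PoszD mulrDl mul1r.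
Qed.

Lemma polar_pole lo hi r s : (lo <= r <= hi)%N -> polar lo hi (pole r s).
Proof.
move=> h; exists [:: (r, s)]; first by rewrite /= h.
by move=> d; rewrite big_seq1.
Qed.

Lemma polar_psum lo hi f : polar lo hi f -> polar lo.+1 hi.+1 (psum f).
Proof.
move=> [l al fE]; exists [seq (x.1.+1, x.2) | x <- l].
  by rewrite all_map; apply: sub_all al => x.
move=> d; rewrite (eq_psum fE) psum_sum big_map; apply: eq_bigr => x _.
exact: psum_pole.
Qed.

Lemma polar_iter_psum p lo hi f : polar lo hi f -> polar (p + lo) (p + hi) (iter p psum f).
Proof. by move=> h; elim: p => //= p IH; apply: polar_psum. Qed.

Definition tail N f d := if (N <= d)%N then f d else 0.

Lemma tail_psum N f : tail N (psum f) =1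
  fun d => psum (tail N f) d + (\sum_(i < N) f i) * pole 1 N d.
Proof.
move=> d; rewrite pole1 /tail; case: leqP => Nd.
  have psumE g : psum g d = \sum_(0 <= i < d.+1) g i by rewrite big_mkord.
  rewrite mulr1 !psumE (big_cat_nat (leq0n N) (leqW Nd)) /= big_mkord addrC.
  congr (_ + _); rewrite [RHS](big_cat_nat (leq0n N) (leqW Nd)) /=.
  have -> : \sum_(0 <= i < N) (if (N <= i)%N then f i else 0) = 0.
    by rewrite big_nat big1 // => i /andP[_]; rewrite ltnNge => /negbTE ->.
  by rewrite add0r big_nat [RHS]big_nat; apply: eq_bigr => i /andP[-> _].
rewrite mulr0 addr0 /psum big1 // => i _; case: ifP => // h.
by have := ltn_ord i; lia.
Qed.

(** Induction on [r] through [tail_psum]: truncating f / (1 - T) gives the truncation of f over 1 -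
    T, plus T^N / (1 - T) times the sum of the discarded coefficients of f, which is nonnegative
    here. *)
Lemma polar_tail_pole N r s : polar 0 r (tail N (pole r s)).
Proof.
elim: r => [|r IH].
  case: (leqP N s) => Ns.
    apply: (@polar_ext _ _ (pole 0 s)); last exact: polar_pole.
    move=> d; rewrite /tail pole0; case: eqP => [->|_]; first by rewrite Ns.
    by case: ifP.
  apply: polar_ext (polar0 _ _) => d; rewrite /tail pole0; case: leqP => // Nd.
  by case: eqP => // e; lia.
apply: (@polar_ext _ _ (tail N (psum (pole r s)))).
  by move=> d; rewrite /tail psum_pole.
apply: polar_ext (fsym (tail_psum _ _)) _.
apply: polarD; first exact: polar_weak (polar_psum IH).
apply: polarM; last exact: polar_pole.
by apply: sumr_ge0 => i _; apply: pole_ge0.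
Qed.

(* The coefficients of (1-T)^p times the Hilbert series of M(n, k+1): from here on
   k stands for the paper's k - 1. *)
Definition hdiff n k p d : int := if (k.+1 <= d)%N then
  \sum_(t < n - p) ('C(p + t, k) * 'C(d - k.+1 + t, t))%:Z
    + (-1) ^+ (d - k.+1) * ('C(p, d))%:Z else 0.

(** The closed form arises by multiplying each C(t,k) T^(k+1) / (1-T)^(t+1) by (1-T)^p. Terms with t
    >= p remain poles; those with t < p become polynomials, and their coefficients (-1)^s C(t,k)
    C(p-1-t,s) add up to (-1)^s C(p,k+1+s). The proof checks the recursion in p instead, which is
    Pascal's rule. *)
Lemma psum_hdiff n k p : (p < n)%N -> psum (hdiff n k p.+1) =1 hdiff n k p.
Proof.
move=> pn; apply: psumP; first by rewrite /hdiff.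
move=> d; rewrite /hdiff.
case: (ltnP k d.+1) => [kd|dk]; last by rewrite (_ : (k < d)%N = false) ?addr0 //; lia.
case: (ltnP k d) => [{}kd|dk].
  rewrite (_ : d.+1 - k.+1 = (d - k.+1).+1)%N; last lia.
  set s := (d - k.+1)%N; set e := (n - p.+1)%N.
  rewrite (_ : n - p = e.+1)%N; last by rewrite /e; lia.
  rewrite !big_ord_recl /= !bin0 addn0 muln1 binS PoszD exprS mulN1r mulrDr.
  have -> : \sum_(i < e) ('C(p + bump 0 i, k) * 'C(s.+1 + bump 0 i, bump 0 i))%:Z =
    \sum_(i < e) ('C(p + bump 0 i, k) * 'C(s + bump 0 i, bump 0 i))%:Z +
    \sum_(i < e) ('C(p.+1 + i, k) * 'C(s.+1 + i, i))%:Z.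
    rewrite -big_split /=; apply: eq_bigr => i _.
    rewrite /bump /= !add1n !addnS !addSn binS mulnDr PoszD.
    by [].
  rewrite !mulNr.
  move: (\sum_(i < e) _) (\sum_(i < e) _) ((-1) ^+ s * _) ((-1) ^+ s * _) => x y z t; lia.
have -> : d = k by lia.
rewrite subnn add0r !expr0 !mul1r.
(* In the lowest degree k + 1 the value is C(n, k+1), the number of generators, whatever the power
   of 1 - T. *)
have sumE q : (q <= n)%N ->
    (\sum_(t < n - q) ('C(q + t, k) * 'C(0 + t, t))%:Z + ('C(q, k.+1))%:Z = ('C(n, k.+1))%:Z).
  move=> qn; rewrite -[in RHS](subnKC qn); elim: (n - q)%N => [|m IH].
    by rewrite big_ord0 add0r addn0.
  by rewrite big_ord_recr /= addrAC IH add0n binn muln1 addnS binS PoszD.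
by rewrite !sumE // ltnW.
Qed.

End PartialSums.

(** * Hilbert depth as a nonnegativity condition *)

Section HilbertDepth.
Import GRing.Theory Num.Theory Order.TTheory.
Local Open Scope ring_scope.

Lemma iter_psum_hdiff n k p : (p <= n)%N -> iter p psum (hdiff n k p) =1 hdiff n k 0.
Proof.
elim: p => // p IH pn d; rewrite iterSr -(IH (ltnW pn)).
by apply: eq_iter_psum; apply: psum_hdiff.
Qed.

Lemma hdiff_pole n k p d : (p < d)%N ->
  hdiff n k p d = \sum_(t < n - p) ('C(p + t, k))%:Z * pole t.+1 k.+1 d.
Proof.
move=> pd; rewrite /hdiff; case: (ltnP k d) => kd; last first.
  by rewrite big1 // => t _; rewrite pole_lt ?mulr0.
rewrite [('C(p, d))]bin_small // mulr0 addr0; apply: eq_bigr => t _.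
rewrite pole_ge // PoszM /nmono addnS /=; congr (_ * Posz _).
by rewrite -[RHS]bin_sub ?leq_addr // addKn.
Qed.

Lemma hdiff0 n k d : hdiff n k 0 d = (hilbM n k.+1 d)%:Z.
Proof.
case: (posnP d) => [->|d0].
  by rewrite /hdiff hilbME /= big1 // => t _; rewrite muln0.
rewrite hdiff_pole // hilbME subn0 -[RHS]natz natr_sum.
by apply: eq_bigr => t _; rewrite natz PoszM add0n.
Qed.

Lemma hilbM_neg n k d : d < 0 -> hilbM n k.+1 d = 0%N.
Proof.
move=> d0; rewrite hilbME big1 // => t _.
case E: (d - k.+1%:Z) => [a|a]; [lia|by rewrite muln0].
Qed.

(** Nonnegativity alone would only give an infinite sum of copies of K. Beyond degree p the term
    C(p,d) vanishes, and what remains is a nonnegative combination of truncated poles of order at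
    most n - p; poles of order 0 fill the finitely many degrees up to p. *)
Lemma polar_hdiff n k p : (p <= n)%N -> (forall d, 0 <= hdiff n k p d) ->
  polar 0 (n - p) (hdiff n k p).
Proof.
move=> pn h.
apply: (@polar_ext _ _ (fun d => \sum_(i <- iota 0 p.+1) hdiff n k p i * pole 0 i d +
   \sum_(t <- enum 'I_(n - p)) ('C(p + t, k))%:Z * tail p.+1 (pole t.+1 k.+1) d)).
  move=> d; case: (leqP d p) => dp.
    rewrite [X in _ + X]big1 ?addr0 => [|t _]; last by rewrite /tail ltnNge dp mulr0.
    rewrite (bigD1_seq d) ?iota_uniq ?mem_iota //= pole0 eqxx mulr1 big1 ?addr0 // => i id.
    by rewrite pole0 eq_sym (negbTE id) mulr0.
  rewrite big_seq big1 ?add0r => [|i].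
    rewrite hdiff_pole // big_enum /=; apply: eq_bigr => t _.
    by rewrite /tail dp.
  rewrite mem_iota pole0 => /andP[_ ip]; case: eqP => [e|_]; [lia|by rewrite mulr0].
apply: polarD; apply: polar_sum => i _; apply: polarM => //.
  exact: polar_pole.
by apply: polar_weak (polar_tail_pole _ _ _).
Qed.

Definition admissible n k p := (p <= n)%N /\ forall d, 0 <= hdiff n k p d.

(** Lowering the power of 1 - T by one means taking partial sums, which keeps coefficients
    nonnegative. *)
Lemma admissible_le n k p q : (p <= q)%N -> admissible n k q -> admissible n k p.
Proof.
move=> pq [qn]; have pn := leq_trans pq qn; split=> //.
rewrite -(subnKC pq) in qn b *; elim: (q - p)%N qn b => [|m IH] qn h d.
  by rewrite -[p]addn0.
rewrite addnS in qn h; apply: IH; first exact: ltnW.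
by move=> d'; rewrite -psum_hdiff //; apply: psum_ge0.
Qed.

Lemma admissible0 n k : admissible n k 0.
Proof. by split=> // d; rewrite hdiff0. Qed.

Variable K : fieldType.

(** Dividing by (1 - T)^p raises the pole orders from [0, n - p] to [p, n]. A pole of order r <= n
    is realised by the subalgebra on r of the variables, given by [pid_mx]. *)
Lemma admissible_Hdecomp n k p : admissible n k p ->
  exists m q (A : forall i : 'I_m, 'M[K]_(q i, n)) s,
   is_Hdecomp k.+1 A s /\ forall i, (p <= retract_dim (A i))%N.
Proof.
case=> pn h; have := polar_iter_psum p (polar_hdiff pn h).
rewrite addn0 subnKC // => -[l /allP al lE].
exists (size l), (fun i => (tnth (in_tuple l) i).1),
  (fun i => pid_mx (tnth (in_tuple l) i).1), (fun i => (tnth (in_tuple l) i).2%:Z).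
have rk i : retract_dim (pid_mx (tnth (in_tuple l) i).1 : 'M[K]_((tnth (in_tuple l) i).1, n))
    = (tnth (in_tuple l) i).1.
  by apply: rank_pid_mx => //; have /andP[] := al _ (mem_tnth i (in_tuple l)).
split; last by move=> i; rewrite rk; have /andP[] := al _ (mem_tnth i (in_tuple l)).
apply/is_HdecompE => // -[d|d].
  apply/eqP; rewrite -eqz_nat -hdiff0 -(iter_psum_hdiff k pn) lE.
  rewrite (big_tnth _ _ l) -[X in _ == X]natz natr_sum; apply/eqP/eq_bigr => i _.
  by rewrite rk natz.
rewrite hilbM_neg // big1 // => i _.
case E: (Negz d - (tnth (in_tuple l) i).2%:Z) => [a|//]; lia.
Qed.

(** Each summand is a pole of order at least p, so cancelling (1 - T)^p leaves poles, whose
    coefficients are nonnegative. A negative shift would create dimension in a negative degree,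
    where M(n,k+1) vanishes. *)
Lemma Hdecomp_admissible n k m q (A : forall i : 'I_m, 'M[K]_(q i, n)) s p :
  (k < n)%N -> is_Hdecomp k.+1 A s -> (forall i, (p <= retract_dim (A i))%N) ->
  admissible n k p.
Proof.
move=> kn /is_HdecompE h hp.
have {}h d := h (ltn0Sn _) d.
have s0 i : 0 <= s i.
  case: (leP 0 (s i)) => // si; have := h (s i); rewrite hilbM_neg // (bigD1 i) //=.
  by rewrite subrr /= nmonor0.
have pn : (p <= n)%N.
  (* Since k < n, the module is nonzero and the family has a member, whose rank bounds [p]. *)
  have : (0 < hilbM n k.+1 k.+1%:Z)%N.
    rewrite hilbME subrr /=.
    rewrite (bigD1 (Ordinal kn)) //= binn nmonor0.
    by [].
  case: m q A s hp h s0 => [|m] q A s hp h s0; first by rewrite h big_ord0.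
  by move=> _; apply: leq_trans (hp ord0) _; apply: rank_leq_col.
split=> // d.
pose g d := \sum_i pole (retract_dim (A i) - p) `|s i|%N d.
suff -> : hdiff n k p d = g d by apply: sumr_ge0 => i _; apply: pole_ge0.
move: d; apply: (@iter_psum_inj p) => d.
rewrite iter_psum_hdiff // hdiff0 h iter_psum_sum -natz natr_sum.
apply: eq_bigr => i _; rewrite iter_psum_pole subnKC // natz /pole.
by rewrite gez0_abs.
Qed.

(** Argued classically: it serves for [admissible], which quantifies over all degrees, and for
    inequalities between reals. *)
Lemma ex_max (P : nat -> Prop) b : P 0%N -> (forall p, P p -> (p <= b)%N) ->
  exists2 h, P h & forall p, P p -> (p <= h)%N.
Proof.
move=> P0; elim: b => [|b IH] Pb; first by exists 0%N.
case: (classic (P b.+1)) => [Pb1|nP]; first by exists b.+1.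
apply: IH => p Pp; have := Pb _ Pp; rewrite leq_eqVlt => /orP[/eqP e|//].
by rewrite e in Pp.
Qed.

Lemma Hdepth1_admissible n k : (k < n)%N -> exists h,
  [/\ is_Hdepth1 K n k.+1 h, admissible n k h & forall p, admissible n k p -> (p <= h)%N].
Proof.
move=> kn; have [|h ah hmax] := @ex_max (admissible n k) n (admissible0 n k).
  by move=> p [].
exists h; split=> //; split; first exact: admissible_Hdecomp.
by move=> m q A s h' hA hr; apply: hmax; apply: Hdecomp_admissible hA hr.
Qed.

Lemma admissibleP n k p : (p <= n)%N -> (admissible n k p <->
  forall s, odd s -> ('C(p, k.+1 + s) <= \sum_(t < n - p) 'C(p + t, k) * 'C(s + t, t))%N).
Proof.
move=> pn.
have E s : hdiff n k p (k.+1 + s) = (\sum_(t < n - p) 'C(p + t, k) * 'C(s + t, t))%N%:Z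
    + (-1) ^+ s * ('C(p, k.+1 + s))%:Z.
  rewrite /hdiff leq_addr addKn; congr (_ + _).
  by rewrite -[RHS]natz natr_sum; apply: eq_bigr => t _; rewrite natz.
split=> [[_ h] s os|h].
  by have := h (k.+1 + s)%N; rewrite E -signr_odd os expr1 mulN1r subr_ge0 lez_nat.
split=> // d; case: (leqP k.+1 d) => kd; last by rewrite /hdiff leqNgt kd.
rewrite -(subnKC kd) E -signr_odd; case: (boolP (odd _)) => [/h|_].
  by rewrite expr1 mulN1r subr_ge0 lez_nat.
by rewrite expr0 mul1r.
Qed.

End HilbertDepth.

(** * Reduction to an inequality between binomial coefficients *)

Section BinomialBounds.
Local Open Scope nat_scope.

Lemma hockey_stick s e : \sum_(t < e) 'C(s + t, t) = 'C(s + e, s.+1).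
Proof.
elim: e => [|e IH]; first by rewrite big_ord0 addn0 bin_small.
rewrite big_ord_recr /= IH addnS binS; congr (_ + _).
by rewrite -[RHS]bin_sub ?leq_addr // addKn.
Qed.

Lemma weighted_hockey_stick_ge p e k s :
  'C(p, k) * 'C(s + e, s.+1) <= \sum_(t < e) 'C(p + t, k) * 'C(s + t, t).
Proof.
rewrite -hockey_stick big_distrr /=; apply: leq_sum => t _.
by rewrite leq_mul2r leq_bin2l ?orbT // leq_addr.
Qed.

Lemma weighted_hockey_stick_le p e k s :
  \sum_(t < e) 'C(p + t, k) * 'C(s + t, t) <= 'C(p + e, k) * 'C(s + e, s.+1).
Proof.
rewrite -hockey_stick big_distrr /=; apply: leq_sum => t _.
by rewrite leq_mul2r leq_bin2l ?orbT // leq_add2l ltnW.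
Qed.

Lemma bin_mul_bin p k d : 'C(p, k + d) * 'C(k + d, k) = 'C(p, k) * 'C(p - k, d).
Proof.
case: (leqP (k + d) p) => h; last first.
  rewrite bin_small // mul0n; case: (leqP k p) => kp; last by rewrite bin_small.
  by rewrite ['C(p - k, d)]bin_small ?muln0 //; lia.
have kp : k <= p by lia.
apply/eqP; rewrite -(eqn_pmul2r (fact_gt0 k)) -(eqn_pmul2r (fact_gt0 d)) 
   -(eqn_pmul2r (fact_gt0 (p - k - d))).
have h1 := bin_fact h; have h2 := bin_fact (leq_addr d k); have h3 := bin_fact kp.
have dk : d <= p - k by lia.
have h4 := bin_fact dk; rewrite addKn in h2; rewrite subnDA in h1.
apply/eqP.
transitivity (p`!).
  by rewrite -h1 -h2 !mulnA.
by rewrite -h3 -h4 !mulnA; congr (_ * _ * _); rewrite mulnAC.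
Qed.

(** With d = s + 1, multiplying by C(k+d,k) turns C(p,k+d) into C(p,k) C(p-k,d), and the factor
    C(p,k) cancels against the one in the lower estimate of the sum. *)
Lemma admissible_of_bin n k p : p <= n ->
  (forall d, 0 < d -> 'C(p - k, d) <= 'C(k + d, k) * 'C(n - p + d.-1, d)) ->
  admissible n k p.
Proof.
move=> pn h; apply/admissibleP => // s _.
apply: leq_trans (weighted_hockey_stick_ge _ _ _ _).
rewrite addSnnS.
have c0 : 0 < 'C(k + s.+1, k) by rewrite bin_gt0 leq_addr.
rewrite -(leq_pmul2r c0) bin_mul_bin -mulnA leq_mul2l; apply/orP; right.
by rewrite mulnC (addnC s); apply: (h s.+1).
Qed.

(** Here the upper estimate of the sum leaves the quotient C(n,k) / C(p,k), which stays bounded when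
    p is at least a fixed fraction of n. The parity of d is that of an odd s = d - 1. *)
Lemma admissible_bin n k p d : admissible n k p -> 0 < d -> ~~ odd d ->
  'C(p, k) * 'C(p - k, d) <= 'C(n, k) * 'C(k + d, k) * 'C(n - p + d.-1, d).
Proof.
case: d => // s ap _; rewrite /= negbK => os.
have pn : p <= n by case: ap.
have := leq_trans (proj1 (admissibleP k pn) ap s os) (weighted_hockey_stick_le _ _ _ _).
rewrite addSnnS subnKC // => h.
rewrite -bin_mul_bin mulnAC leq_mul2r; apply/orP; right.
by rewrite (addnC (n - p)).
Qed.

End BinomialBounds.

(** * Exponential bounds for ratios of binomial coefficients *)

Section BinomialRatios.
Local Open Scope R_scope.

Lemma INR_addn m n : INR (m + n)%N = INR m + INR n. Proof. exact: plus_INR. Qed.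

Lemma INR_muln m n : INR (m * n)%N = INR m * INR n. Proof. exact: mult_INR. Qed.

Lemma INR_subn m n : (n <= m)%N -> INR (m - n)%N = INR m - INR n.
Proof. by move=> /leP; apply: minus_INR. Qed.

Lemma INR_leq m n : (m <= n)%N <-> INR m <= INR n.
Proof. by split=> [/leP/le_INR|/INR_le/leP]. Qed.

Lemma INR_ltn m n : (m < n)%N <-> INR m < INR n.
Proof. by split=> [/ltP/lt_INR|/INR_lt/ltP]. Qed.

Lemma INR_binS_left q d : (d <= q)%N ->
  INR d.+1 * INR 'C(q, d.+1) = (INR q - INR d) * INR 'C(q, d).
Proof. by move=> dq; rewrite -INR_subn // -!INR_muln mul_bin_left. Qed.

Lemma INR_binS_diag e d : (0 < e)%N ->
  INR d.+1 * INR 'C(e + d, d.+1) = (INR e + INR d) * INR 'C(e + d.-1, d).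
Proof.
move=> e0; rewrite -INR_addn -!INR_muln -mul_bin_diag; congr (INR (_ * _)).
case: d => [|d] /=; last by rewrite addnS.
by rewrite !bin0.
Qed.

Lemma exp_ge x : 1 + x <= exp x. Proof. by have := exp_ineq1_le x. Qed.

Lemma exp_mono x y : x <= y -> exp x <= exp y.
Proof. by case=> [/exp_increasing|->]; [left|right]. Qed.

Section Ratio.
Variables (q e : nat).
Hypothesis e0 : (0 < e)%N.

(** C(q,d) / C(e+d-1,d) is the product of (q-i)/(e+i) over i < d; [y] bounds the factor i = d. In
    use q is p - k and e is n - p. *)
Lemma bin_ratio_step (x y : R) d : (d <= q)%N -> 0 <= x -> 
  INR 'C(q, d) <= x * INR 'C(e + d.-1, d) ->
  INR q - INR d <= y * (INR e + INR d) -> 0 <= y ->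
  INR 'C(q, d.+1) <= x * y * INR 'C(e + d, d.+1).
Proof.
move=> dq x0 IH hy y0.
have d1 : 0 < INR d.+1 by apply: lt_0_INR; apply/ltP.
apply: (Rmult_le_reg_l (INR d.+1)) => //.
rewrite INR_binS_left //.
have -> : INR d.+1 * (x * y * INR 'C(e + d, d.+1)) =
  (x * y) * (INR d.+1 * INR 'C(e + d, d.+1)) by ring.
rewrite INR_binS_diag //.
have dq' : 0 <= INR q - INR d by move/INR_leq: dq; lra.
have c0 := pos_INR 'C(q, d); have c1 := pos_INR 'C(e + d.-1, d).
apply: (Rle_trans _ (y * (INR e + INR d) * INR 'C(q, d))).
  exact: Rmult_le_compat_r.
have -> : x * y * ((INR e + INR d) * INR 'C(e + d.-1, d)) =
  y * (INR e + INR d) * (x * INR 'C(e + d.-1, d)) by ring.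
by apply: Rmult_le_compat_l => //; lra.
Qed.

(** Each factor is at most q/e <= exp((q-e)/e). *)
Lemma bin_ratio_le_linear d : (e <= q)%N ->
  INR 'C(q, d) <= exp ((INR q - INR e) / INR e * INR d) * INR 'C(e + d.-1, d).
Proof.
move=> eq; have e1 : 0 < INR e by exact: (proj1 (INR_ltn _ _) e0).
have qe : INR e <= INR q := proj1 (INR_leq _ _) eq.
elim: d => [|d IH]; first by rewrite !bin0 /= Rmult_0_r exp_0; lra.
case: (leqP d.+1 q) => dq; last first.
  by rewrite bin_small //=; apply: Rmult_le_pos; [left; apply: exp_pos|apply: pos_INR].
rewrite S_INR Rmult_plus_distr_l exp_plus Rmult_1_r.
apply: bin_ratio_step => //; [exact: ltnW|left; exact: exp_pos| |left; exact: exp_pos].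
have h := exp_ge ((INR q - INR e) / INR e).
have -> : INR q - INR d = INR q / INR e * INR e - INR d by field; lra.
have -> : INR q / INR e = 1 + (INR q - INR e) / INR e by field; lra.
have d0 := pos_INR d.
have : (1 + (INR q - INR e) / INR e) * INR e <= exp ((INR q - INR e) / INR e) * INR e.
  by apply: Rmult_le_compat_r; lra.
have : 0 <= exp ((INR q - INR e) / INR e) * INR d.
  by apply: Rmult_le_pos => //; left; apply: exp_pos.
lra.
Qed.

(** As long as q-e-2i >= 0, the factor 1 + (q-e-2i)/(e+i) is at most exp((q-e-2i)/e); the numerators
    sum to d (q-e+1-d). *)
Lemma bin_ratio_le_quadratic d : INR d + INR d <= INR q - INR e + 2 ->
  INR 'C(q, d) <= exp (INR d * (INR q - INR e + 1 - INR d) / INR e) * INR 'C(e + d.-1, d).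
Proof.
have e1 : 0 < INR e by exact: (proj1 (INR_ltn _ _) e0).
elim: d => [|d IH] hd; first by rewrite !bin0 /= Rmult_0_l /Rdiv Rmult_0_l exp_0; lra.
case: (leqP d.+1 q) => dq; last first.
  by rewrite bin_small //=; apply: Rmult_le_pos; [left; apply: exp_pos|apply: pos_INR].
rewrite S_INR in hd *.
have -> : (INR d + 1) * (INR q - INR e + 1 - (INR d + 1)) / INR e =
  INR d * (INR q - INR e + 1 - INR d) / INR e + (INR q - INR e - 2 * INR d) / INR e.
  by field; lra.
rewrite exp_plus.
apply: bin_ratio_step; [exact: ltnW|left; exact: exp_pos|apply: IH; lra| |left; exact: exp_pos].
have h := exp_ge ((INR q - INR e - 2 * INR d) / INR e).
have d0 := pos_INR d.
have t0 : 0 <= (INR q - INR e - 2 * INR d) / INR e by apply: Rle_mult_inv_pos; lra.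
have : (1 + (INR q - INR e - 2 * INR d) / INR e) * (INR e + INR d) <=
  exp ((INR q - INR e - 2 * INR d) / INR e) * (INR e + INR d).
  by apply: Rmult_le_compat_r; lra.
have : (1 + (INR q - INR e - 2 * INR d) / INR e) * (INR e + INR d) =
  INR e + INR d + (INR q - INR e - 2 * INR d) + (INR q - INR e - 2 * INR d) / INR e * INR d.
  by field; lra.
have := Rmult_le_pos _ _ t0 d0.
lra.
Qed.

(** The quadratic exponent peaks at d = (q-e+1)/2, and factors with 2i >= q-e are at most 1, so the
    peak value bounds all later ratios. *)
Lemma bin_ratio_le d : INR 'C(q, d) <=
  exp ((INR q - INR e + 1) ^ 2 / (4 * INR e)) * INR 'C(e + d.-1, d).
Proof.
have e1 : 0 < INR e by exact: (proj1 (INR_ltn _ _) e0).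
have exp1 : 1 <= exp ((INR q - INR e + 1) ^ 2 / (4 * INR e)).
  apply: Rle_trans (exp_ge _).
  suff : 0 <= (INR q - INR e + 1) ^ 2 / (4 * INR e) by lra.
  by apply: Rle_mult_inv_pos; [apply: pow2_ge_0|lra].
elim: d => [|d IH]; first by rewrite !bin0 (_ : INR 1 = 1) //; lra.
case: (Rle_lt_dec (INR d.+1 + INR d.+1) (INR q - INR e + 2)) => hd.
  apply: Rle_trans (bin_ratio_le_quadratic hd) _.
  apply: Rmult_le_compat_r; first exact: pos_INR.
  apply: exp_mono; rewrite -(Rmult_1_l (_ / _)) /Rdiv Rmult_1_l.
  apply: (Rmult_le_reg_r (4 * INR e)); first lra.
  have -> : INR d.+1 * (INR q - INR e + 1 - INR d.+1) * / INR e * (4 * INR e) =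
    4 * (INR d.+1 * (INR q - INR e + 1 - INR d.+1)) by field; lra.
  have -> : (INR q - INR e + 1) ^ 2 * / (4 * INR e) * (4 * INR e) =
     (INR q - INR e + 1) ^ 2 by field; lra.
  have := pow2_ge_0 (INR q - INR e + 1 - 2 * INR d.+1); lra.
case: (leqP d.+1 q) => dq; last first.
  rewrite bin_small //; apply: Rmult_le_pos; [lra|exact: pos_INR].
rewrite -[X in X * _]Rmult_1_r.
apply: bin_ratio_step; [exact: ltnW|lra|exact: IH| |lra].
rewrite S_INR in hd; lra.
Qed.

(** With t = q-e-2i the factor is 1 + t/(e+i), and e+i <= (q+e)/2, so it is at least 1 + z >= exp(z
    - z^2) for z = 2t/(q+e). The z sum to the first term of the exponent; t <= q-e bounds the sum of
    the z^2 by the second. *)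
Lemma bin_ratio_ge d : (e <= q)%N -> INR d + INR d <= INR q - INR e + 2 ->
  exp (2 / (INR q + INR e) * (INR d * (INR q - INR e + 1 - INR d))
       - 4 * INR d * (INR q - INR e) ^ 2 / (INR q + INR e) ^ 2) * INR 'C(e + d.-1, d)
  <= INR 'C(q, d).
Proof.
move=> eq; have e1 : 0 < INR e by exact: (proj1 (INR_ltn _ _) e0).
have qe : INR e <= INR q := proj1 (INR_leq _ _) eq.
set s := INR q + INR e; have s0 : 0 < s by rewrite /s; lra.
elim: d => [|d IH] hd.
  rewrite !bin0 /= (_ : _ - _ = 0) ?exp_0; last by field; lra.
  lra.
rewrite S_INR in hd.
have dq : (d <= q)%N by apply: (proj2 (INR_leq _ _)); lra.
pose t := INR q - INR e - 2 * INR d.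
have t0 : 0 <= t by rewrite /t; lra.
pose z := 2 * t / s.
have z0 : 0 <= z by apply: Rle_mult_inv_pos => //; lra.
have d1 : 0 < INR d.+1 by apply: lt_0_INR; apply/ltP.
have d0 := pos_INR d.
apply: (Rle_trans _ (exp (2 / s * (INR d * (INR q - INR e + 1 - INR d))
       - 4 * INR d * (INR q - INR e) ^ 2 / s ^ 2) * exp (z - z ^ 2) * INR 'C(e + d, d.+1))).
  apply: Rmult_le_compat_r; first exact: pos_INR.
  rewrite -exp_plus; apply: exp_mono.
  have -> : 2 / s * (INR d * (INR q - INR e + 1 - INR d)) -
    4 * INR d * (INR q - INR e) ^ 2 / s ^ 2 + (z - z ^ 2) =
   2 / s * ((INR d + 1) * (INR q - INR e + 1 - (INR d + 1))) -
    (4 * INR d * (INR q - INR e) ^ 2 + 4 * t ^ 2) / s ^ 2.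
    by rewrite /z /t; field; lra.
  rewrite S_INR.
  suff : (4 * INR d * (INR q - INR e) ^ 2 + 4 * t ^ 2) / s ^ 2 <=
         4 * (INR d + 1) * (INR q - INR e) ^ 2 / s ^ 2 by lra.
  apply: Rmult_le_compat_r; first by left; apply: Rinv_0_lt_compat; apply: pow_lt.
  suff : t ^ 2 <= (INR q - INR e) ^ 2 by lra.
  by apply: pow_incr; rewrite /t; lra.
have ez : exp (z - z ^ 2) * (INR e + INR d) <= INR q - INR d.
  (* exp(-w) >= 1 - w at w = z / (1 + z) gives 1 + z >= exp(z / (1 + z)) >= exp(z - z^2). *)
  have h1 : exp (z - z ^ 2) <= 1 + z.
    apply: (Rle_trans _ (exp (z / (1 + z)))).
      apply: exp_mono; apply: (Rmult_le_reg_r (1 + z)); first lra.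
      rewrite /Rdiv Rmult_assoc Rinv_l; last lra.
      have : 0 <= z ^ 3 by apply: pow_le.
      lra.
    have := exp_ge (- (z / (1 + z))); rewrite exp_Ropp.
    have -> : 1 + - (z / (1 + z)) = / (1 + z) by field; lra.
    have z1 : 0 < / (1 + z) by apply: Rinv_0_lt_compat; lra.
    by move/(Rinv_le_contravar _ _ z1); rewrite !Rinv_inv.
  apply: (Rle_trans _ ((1 + z) * (INR e + INR d))).
    by apply: Rmult_le_compat_r => //; lra.
  suff : z * (INR e + INR d) <= t by rewrite /t; lra.
  apply: (Rle_trans _ (z * (s / 2))).
    by apply: Rmult_le_compat_l => //; rewrite /s; lra.
  by right; rewrite /z; field; lra.
apply: (Rmult_le_reg_l (INR d.+1)) => //.
rewrite INR_binS_left //.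
set E := exp _ in IH *.
have -> : INR d.+1 * (E * exp (z - z ^ 2) * INR 'C(e + d, d.+1)) =
  E * exp (z - z ^ 2) * (INR d.+1 * INR 'C(e + d, d.+1)) by ring.
rewrite INR_binS_diag //.
have -> : E * exp (z - z ^ 2) * ((INR e + INR d) * INR 'C(e + d.-1, d)) =
  (exp (z - z ^ 2) * (INR e + INR d)) * (E * INR 'C(e + d.-1, d)) by ring.
apply: Rmult_le_compat => //; last by apply: IH; lra.
  by apply: Rmult_le_pos; [left; apply: exp_pos|lra].
by apply: Rmult_le_pos; [left; apply: exp_pos|apply: pos_INR].
Qed.

End Ratio.

Lemma INR_bin_fact_le m j : INR 'C(m, j) * INR (j`!)%N <= INR m ^ j.
Proof.
rewrite -INR_muln bin_ffact -[INR m ^ j]pow_INR.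
suff : (m ^_ j <= Nat.pow m j)%N by move/INR_leq.
elim: j => [|j IH] //; rewrite ffactnSr /= mulnC.
by apply: leq_mul => //; apply: leq_subr.
Qed.

Lemma INR_bin_fact_ge m j : INR m ^ j <= INR 'C(m + j, j) * INR (j`!)%N.
Proof.
rewrite -INR_muln bin_ffact -pow_INR.
suff : (Nat.pow m j <= (m + j) ^_ j)%N by move/INR_leq.
elim: j => [|j IH] //; rewrite addnS ffactSS /=.
by apply: leq_mul => //; apply: leqW; apply: leq_addr.
Qed.

End BinomialRatios.

(** * Growth of logarithms *)

Section Asymptotics.
Local Open Scope R_scope.

Definition eventually (P : nat -> Prop) := exists N, forall n, (N <= n)%N -> P n.

Lemma eventually_and P Q : eventually P -> eventually Q -> eventually (fun n => P n /\ Q n).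
Proof.
move=> [N hP] [N' hQ]; exists (maxn N N') => n; rewrite geq_max => /andP[h h'].
by split; [apply: hP|apply: hQ].
Qed.

Lemma eventually_imp (P Q : nat -> Prop) :
  (forall n, P n -> Q n) -> eventually P -> eventually Q.
Proof. by move=> PQ [N hP]; exists N => n /hP /PQ. Qed.

Lemma eventually_geq m : eventually (fun n => (m <= n)%N).
Proof. by exists m. Qed.

Lemma nat_floor x : 0 <= x -> exists p, INR p <= x < INR p + 1.
Proof.
move=> x0; have [m hm] := INR_unbounded x.
have [|p hp pmax] := @ex_max (fun p => INR p <= x) m x0.
  move=> p hp; apply: (proj2 (INR_leq _ _)); lra.
exists p; split => //; apply: Rnot_le_lt => h.
by have := pmax p.+1; rewrite S_INR ltnn => /(_ h).
Qed.

Lemma sq_le x y : 0 <= y -> x ^ 2 <= y ^ 2 -> x <= y.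
Proof. by move=> y0 h; apply: Rsqr_incr_0_var => //; rewrite !Rsqr_pow2. Qed.

Lemma ln_mono x y : 0 < x -> x <= y -> ln x <= ln y.
Proof. by move=> x0 [/(ln_increasing _ _ x0)|->]; [left|right]. Qed.

Lemma ln_quot x y : 0 < x -> 0 < y -> ln (x / y) = ln x - ln y.
Proof.
by move=> x0 y0; rewrite /Rdiv ln_mult ?ln_Rinv //; apply: Rinv_0_lt_compat.
Qed.

(** From exp t = exp(t/4)^4 >= t^4 / 256; used for t = ln n and t = ln ln n. *)
Lemma cube_le_exp delta t : 0 < delta -> 256 / delta <= t -> t ^ 3 <= delta * exp t.
Proof.
move=> d0 dt; have t0 : 0 < t by have := Rdiv_lt_0_compat 256 delta; lra.
have dt' : 256 <= delta * t.
  have -> : 256 = delta * (256 / delta) by field; lra.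
  by apply: Rmult_le_compat_l; lra.
have h : (t / 4) ^ 4 <= exp t.
  have -> : exp t = exp (t / 4) ^ 4.
    rewrite [in LHS](_ : t = t / 4 + t / 4 + (t / 4 + t / 4)); last by field.
    by rewrite !exp_plus; ring.
  by apply: pow_incr; have := exp_ge (t / 4); lra.
have t3 : 0 < t ^ 3 by apply: pow_lt.
have h1 : 256 * t ^ 3 <= delta * t * t ^ 3 by apply: Rmult_le_compat_r; lra.
have h2 : delta * (t / 4) ^ 4 <= delta * exp t by apply: Rmult_le_compat_l; lra.
lra.
Qed.

Lemma eventually_ln M : eventually (fun n => 0 < INR n /\ M <= ln (INR n)).
Proof.
have [m hm] := INR_unbounded (exp M); exists m => n /INR_leq h.
have := exp_pos M => e0; split; first lra.
by rewrite -(ln_exp M); apply: ln_mono => //; lra.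
Qed.

Lemma eventually_cubes delta M : 0 < delta -> eventually (fun n =>
  [/\ 0 < INR n, M <= ln (INR n), M <= ln (ln (INR n)),
      ln (INR n) ^ 3 <= delta * INR n & ln (ln (INR n)) ^ 3 <= delta * ln (INR n)]).
Proof.
move=> d0; pose B := Rmax M (256 / delta).
have hM : M <= B by apply: Rmax_l.
have hd : 256 / delta <= B by apply: Rmax_r.
apply: eventually_imp (eventually_ln (exp B)) => n [n0 hL].
have eB := exp_ge B; have eB0 := exp_pos B.
have hl : B <= ln (ln (INR n)) by rewrite -{1}(ln_exp B); apply: ln_mono => //; lra.
split=> //; try lra.
  rewrite -{2}(exp_ln (INR n)) //; apply: cube_le_exp => //; lra.
rewrite -{2}(exp_ln (ln (INR n))); last lra.
apply: cube_le_exp => //; lra.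
Qed.

(* The estimates on L = ln N, l = ln ln N and rt = sqrt (N L) valid for all large N;
   rg_tau says that L^3 / N is at most tau^2. *)
Record regime (tau A B N L l rt : R) : Prop := Regime {
  rg_N : 1 <= N; rg_L : 1 <= L; rg_l : 1 <= l; rg_BL : B <= L; rg_Bl : B <= l;
  rg_rt : 0 < rt; rg_rt2 : rt * rt = N * L; rg_tau : L * rt <= tau * N;
  rg_Lrt : L <= rt; rg_Al : A * l <= L; rg_l2 : l * l <= L;
  rg_lnN : ln N = L; rg_lnL : ln L = l; rg_lnrt : ln rt = (L + l) / 2 }.

Lemma eventually_regime tau A B : 0 < tau -> 0 < A -> eventually (fun n =>
  regime tau A B (INR n) (ln (INR n)) (ln (ln (INR n))) (sqrt (INR n * ln (INR n)))).
Proof.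
move=> tau0 A0.
(* [tau ^ 2] serves [L * rt <= tau * N], whose square is L^3 <= tau^2 N; 1 serves [L <= rt] and
   [l * l <= L]; [/ A] serves [A * l <= L]. *)
pose delta := Rmin (tau ^ 2) (Rmin 1 (/ A)).
have tau2 : 0 < tau ^ 2 by apply: pow_lt.
have iA : 0 < / A by apply: Rinv_0_lt_compat.
have d0 : 0 < delta by rewrite /delta; do 2 (apply: Rmin_glb_lt => //); lra.
have d1 : delta <= tau ^ 2 by apply: Rmin_l.
have d2 : delta <= 1 by apply: Rle_trans (Rmin_r _ _) (Rmin_l _ _).
have d3 : delta <= / A by apply: Rle_trans (Rmin_r _ _) (Rmin_r _ _).
apply: eventually_imp (eventually_cubes (Rmax B 1) d0) => n [].
set N := INR n; set L := ln N; set l := ln L.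
have B1 := Rmax_l B 1; have B2 := Rmax_r B 1.
move=> N0 hL hl cL cl.
have L1 : 1 <= L by lra.
have l1 : 1 <= l by lra.
have NL0 : 0 < N * L by apply: Rmult_lt_0_compat; lra.
have rt0 : 0 < sqrt (N * L) by apply: sqrt_lt_R0.
have rt2 : sqrt (N * L) * sqrt (N * L) = N * L by apply: sqrt_sqrt; lra.
set rt := sqrt (N * L) in rt0 rt2 *.
have L2 : L <= L ^ 2 by rewrite /= Rmult_1_r -{1}(Rmult_1_r L); apply: Rmult_le_compat_l; lra.
have L3 : L ^ 2 <= L ^ 3.
  have -> : L ^ 3 = L ^ 2 * L by ring.
  by rewrite -{1}(Rmult_1_r (L ^ 2)); apply: Rmult_le_compat_l; lra.
have l2 : l <= l ^ 2 by rewrite /= Rmult_1_r -{1}(Rmult_1_r l); apply: Rmult_le_compat_l; lra.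
have l3 : l ^ 2 <= l ^ 3.
  have -> : l ^ 3 = l ^ 2 * l by ring.
  by rewrite -{1}(Rmult_1_r (l ^ 2)); apply: Rmult_le_compat_l; lra.
have dN : delta * N <= N by rewrite -{2}(Rmult_1_l N); apply: Rmult_le_compat_r; lra.
have dL : delta * L <= L by rewrite -{2}(Rmult_1_l L); apply: Rmult_le_compat_r; lra.
split=> //; try lra.
- apply: sq_le; first by apply: Rmult_le_pos; lra.
  have -> : (L * rt) ^ 2 = L ^ 2 * (rt * rt) by ring.
  rewrite rt2; have -> : L ^ 2 * (N * L) = L ^ 3 * N by ring.
  have -> : (tau * N) ^ 2 = tau ^ 2 * N * N by ring.
  apply: Rmult_le_compat_r; first lra.
  apply: Rle_trans cL _; apply: Rmult_le_compat_r; lra.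
- apply: sq_le; first lra.
  have -> : rt ^ 2 = N * L by rewrite -rt2; ring.
  have -> : L ^ 2 = L * L by ring.
  by apply: Rmult_le_compat_r; lra.
- apply: (Rle_trans _ (A * (delta * L))).
    apply: Rmult_le_compat_l; lra.
  rewrite -Rmult_assoc -{2}(Rmult_1_l L); apply: Rmult_le_compat_r; first lra.
  have -> : 1 = A * / A by field; lra.
  by apply: Rmult_le_compat_l; lra.
- have : ln (rt * rt) = ln (N * L) by rewrite rt2.
  rewrite !ln_mult //; try lra.
  rewrite -/L -/l; lra.
Qed.

End Asymptotics.

(** * Exponents near the critical value of p *)

Section CriticalInequalities.
Local Open Scope R_scope.
Variables (J tau A B N L l rt : R).
Hypotheses (J1 : 1 <= J) (rg : regime tau A B N L l rt) (tauE : tau = / (512 * J ^ 3)).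

Lemma pow_J : J <= J ^ 2 /\ J ^ 2 <= J ^ 3.
Proof.
have h : J <= J ^ 2 by rewrite /= Rmult_1_r -{1}(Rmult_1_r J); apply: Rmult_le_compat_l; lra.
split=> //; have -> : J ^ 3 = J ^ 2 * J by ring.
by rewrite -{1}(Rmult_1_r (J ^ 2)); apply: Rmult_le_compat_l; lra.
Qed.

Lemma sqrt_J : 1 <= sqrt J <= J /\ sqrt J * sqrt J = J.
Proof.
have h : sqrt J * sqrt J = J by apply: sqrt_sqrt; lra.
have h1 : 1 <= sqrt J by rewrite -sqrt_1; apply: sqrt_le_1_alt.
split=> //; split=> //; rewrite -{2}h -{1}(Rmult_1_r (sqrt J)).
by apply: Rmult_le_compat_l; lra.
Qed.

Lemma rt_small : 512 * J ^ 3 * (L * rt) <= N.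
Proof.
have [h1 h2] := pow_J; have := rg_tau rg; rewrite tauE => h.
have -> : N = 512 * J ^ 3 * (/ (512 * J ^ 3) * N) by field; lra.
by apply: Rmult_le_compat_l; lra.
Qed.

Lemma rt_le_Lrt : rt <= L * rt.
Proof.
have := rg_L rg; have := rg_rt rg => r0 L1.
by rewrite -{1}(Rmult_1_l rt); apply: Rmult_le_compat_r; lra.
Qed.

Variable a : R.
Hypothesis aA : 2 * Rabs a <= A.

(* The value of 2p - n at the critical p, see main_termE. *)
Definition crit := sqrt J * rt * (1 + a * (l / L)).

Lemma crit_factor : / 2 <= 1 + a * (l / L) <= 3 / 2.
Proof.
have L1 := rg_L rg; have l1 := rg_l rg; have Al := rg_Al rg.
have lL : 0 <= l / L by apply: Rle_mult_inv_pos; lra.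
have h : Rabs (a * (l / L)) <= / 2.
  rewrite Rabs_mult (Rabs_pos_eq (l / L)) //.
  apply: (Rmult_le_reg_r L); first lra.
  have -> : Rabs a * (l / L) * L = Rabs a * l by field; lra.
  have : 2 * Rabs a * l <= A * l by apply: Rmult_le_compat_r; lra.
  lra.
by move: h; rewrite /Rabs; case: Rcase_abs; lra.
Qed.

Lemma crit_ge : rt / 2 <= crit.
Proof.
have [[h1 h2] _] := sqrt_J; have h3 := crit_factor; have r0 := rg_rt rg.
have -> : rt / 2 = 1 * rt * / 2 by field.
apply: Rmult_le_compat; try lra.
by apply: Rmult_le_compat_r; lra.
Qed.

Lemma crit_le : crit <= 2 * J * rt.
Proof.
have [[h1 h2] _] := sqrt_J; have h3 := crit_factor; have r0 := rg_rt rg.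
have -> : 2 * J * rt = J * rt * 2 by ring.
apply: Rmult_le_compat; try lra.
  by apply: Rmult_le_pos; lra.
by apply: Rmult_le_compat_r; lra.
Qed.

Lemma crit_small : 64 * crit <= N.
Proof.
have := rt_small; have := rt_le_Lrt; have := crit_le; have r0 := rg_rt rg.
have [h1 h2] := pow_J => h3 h4 h5.
have : J * rt <= J ^ 3 * (L * rt) by apply: Rmult_le_compat; lra.
have : 0 <= J * rt by apply: Rmult_le_pos; lra.
lra.
Qed.

Lemma crit_sq : crit * crit = N * (J * (L + 2 * a * l + a ^ 2 * (l * l / L))).
Proof.
have L1 := rg_L rg; have [_ h] := sqrt_J; rewrite /crit.
transitivity ((sqrt J * sqrt J) * (rt * rt) * (1 + a * (l / L)) ^ 2); first by ring.
by rewrite h (rg_rt2 rg); field; lra.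
Qed.

Lemma l2L : 0 <= l * l / L <= 1.
Proof.
have L1 := rg_L rg; have l1 := rg_l rg; split.
  by apply: Rle_mult_inv_pos; [apply: Rmult_le_pos|]; lra.
apply: (Rmult_le_reg_r L); first lra.
have -> : l * l / L * L = l * l by field; lra.
by have := rg_l2 rg; lra.
Qed.

Lemma crit_sq_le : crit * crit <= 4 * J * L * N.
Proof.
have r0 := rg_rt rg; have h1 := crit_ge; have L1 := rg_L rg.
have [[s1 s2] s3] := sqrt_J; have := crit_factor => h3.
rewrite (_ : 4 * J * L * N = (2 * (sqrt J * rt)) * (2 * (sqrt J * rt))); last first.
  transitivity (4 * J * (N * L)); first by ring.
  by rewrite -(rg_rt2 rg) -{1}s3; ring.
have h : 0 <= sqrt J * rt by apply: Rmult_le_pos; lra.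
have h' : crit <= 2 * (sqrt J * rt).
  by rewrite /crit Rmult_comm; apply: Rmult_le_compat_r; lra.
by apply: Rmult_le_compat; lra.
Qed.

Section Lower.
(** In use [e] is n - p, [X] is (p - j) - (n - p) + 1, [j1] is j + 1, and [F] is ln j!, the price of
    bounding C(j+d,j) below by d^j / j!. *)
Variables (F c X e j1 : R).
Hypotheses (F0 : 0 <= F) (c0 : 0 < c) (aE : a = / 2 - c) (A6 : 6 <= A).
Hypotheses (XY : X <= crit) (YX : crit - j1 <= X) (eY : (N - crit) / 2 <= e).
Hypotheses (B1 : 11 * J <= B) (B2 : 7 * F <= B) (B3 : 4 * j1 <= B)
  (B4 : (a ^ 2 / 2 + 1 + F + ln 400) / c <= B).

(** The cut between small and medium [d]: low enough for X d / e to stay bounded, high enough for ln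
    v to be a fixed fraction of L. *)
Let v := N / (L * rt).

Lemma lower_X : rt / 4 <= X.
Proof. have := crit_ge; have := rg_BL rg; have := rg_Lrt rg; lra. Qed.

Lemma lower_e : 3 / 8 * N <= e.
Proof. have := crit_small; have := rg_N rg; have := crit_ge; have := rg_rt rg; lra. Qed.

(** Here ln v = (L - 3 l) / 2, which is at least L / 4 as soon as 6 l <= L. *)
Lemma lower_v : 0 < v /\ L / 4 <= ln v.
Proof.
have L1 := rg_L rg; have r0 := rg_rt rg; have N1 := rg_N rg; have l1 := rg_l rg.
have p : 0 < L * rt by apply: Rmult_lt_0_compat; lra.
split; first by apply: Rdiv_lt_0_compat; lra.
rewrite /v ln_quot; try lra.
rewrite ln_mult; try lra.
rewrite (rg_lnN rg) (rg_lnL rg) (rg_lnrt rg).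
have : 6 * l <= A * l by apply: Rmult_le_compat_r; lra.
have := rg_Al rg; lra.
Qed.

Lemma Xe_le : X / e <= 16 / 3 * (J * rt) / N.
Proof.
have e0 := lower_e; have N1 := rg_N rg; have X0 := lower_X; have r0 := rg_rt rg.
apply: (Rmult_le_reg_r e); first lra.
have -> : X / e * e = X by field; lra.
have h := crit_le.
have Jr : 0 <= J * rt by apply: Rmult_le_pos; lra.
apply: (Rle_trans _ (16 / 3 * (J * rt) / N * (3 / 8 * N))).
  have -> : 16 / 3 * (J * rt) / N * (3 / 8 * N) = 2 * (J * rt) by field; lra.
  lra.
apply: Rmult_le_compat_l; last lra.
by apply: Rle_mult_inv_pos; lra.
Qed.

(** The exponent is at most 16 J / (3 L), hence the threshold 11 J for L. The bound 1/2 is chosen so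
    that its exponential is below 2 <= C(j+d,j). *)
Lemma lower_small d : 0 <= d <= v -> X / e * d <= / 2.
Proof.
move=> [d0 dv]; have N1 := rg_N rg; have L1 := rg_L rg; have r0 := rg_rt rg.
have X0 := lower_X; have e0 := lower_e.
have Xe : 0 <= X / e by apply: Rle_mult_inv_pos; lra.
apply: (Rle_trans _ (16 / 3 * (J * rt) / N * v)).
  by apply: Rmult_le_compat => //; apply: Xe_le.
have -> : 16 / 3 * (J * rt) / N * v = 16 / 3 * J / L by rewrite /v; field; lra.
apply: (Rmult_le_reg_r L); first lra.
have -> : 16 / 3 * J / L * L = 16 / 3 * J by field; lra.
have := rg_BL rg; lra.
Qed.

(** The divisor 100 brings X^2 / (100 e) down to (32/300) J L, which leaves room for [F] below J L /
    4 once L >= 7 F. *)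
Lemma lower_medium d : 0 <= d <= X / 100 -> X / e * d + F <= J * ln v.
Proof.
move=> [d0 dv]; have N1 := rg_N rg; have L1 := rg_L rg; have r0 := rg_rt rg.
have X0 := lower_X; have e0 := lower_e; have [v0 lv] := lower_v.
have Xe : 0 <= X / e by apply: Rle_mult_inv_pos; lra.
have h1 : X / e * d <= X / e * (X / 100) by apply: Rmult_le_compat_l.
have h2 : X * X <= crit * crit by apply: Rmult_le_compat; lra.
have h3 := crit_sq_le.
have h4 : X / e * (X / 100) <= 32 / 300 * (J * L).
  apply: (Rmult_le_reg_r e); first lra.
  have -> : X / e * (X / 100) * e = X * X / 100 by field; lra.
  have JL : 0 <= J * L by apply: Rmult_le_pos; lra.
  have : 32 / 300 * (J * L) * (3 / 8 * N) <= 32 / 300 * (J * L) * e.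
    by apply: Rmult_le_compat_l; lra.
  lra.
have h5 : J * (L / 4) <= J * ln v by apply: Rmult_le_compat_l; lra.
have h6 : 1 * L <= J * L by apply: Rmult_le_compat_r; lra.
have := rg_BL rg; lra.
Qed.

(** The peak exponent is crit^2 / (2N) up to a constant, short of J (L + l) / 2 by the margin J c l;
    that margin pays for [F] and for ln 400, which comes from X / 100 >= rt / 400. *)
Lemma lower_large : X ^ 2 / (4 * e) + F <= J * ln (X / 100).
Proof.
have N1 := rg_N rg; have L1 := rg_L rg; have r0 := rg_rt rg; have l1 := rg_l rg.
have X0 := lower_X; have e0 := lower_e; have cs := crit_small; have cg := crit_ge.
have lnX : (L + l) / 2 - ln 400 <= ln (X / 100).
  rewrite -(rg_lnrt rg) -ln_quot; try lra.
  by apply: ln_mono; [apply: Rdiv_lt_0_compat|]; lra.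
have JlnX : J * ((L + l) / 2 - ln 400) <= J * ln (X / 100).
  by apply: Rmult_le_compat_l; lra.
have h1 : X ^ 2 / (4 * e) <= crit * crit / (2 * (N - crit)).
  apply: (Rmult_le_reg_r (4 * e)); first lra.
  have -> : X ^ 2 / (4 * e) * (4 * e) = X * X by field; lra.
  have X2 : X * X <= crit * crit by apply: Rmult_le_compat; lra.
  apply: Rle_trans X2 _.
  have cc : 0 <= crit * crit by apply: Rmult_le_pos; lra.
  apply: (Rle_trans _ (crit * crit / (2 * (N - crit)) * (2 * (N - crit)))).
    by right; field; lra.
  apply: Rmult_le_compat_l; last lra.
  by apply: Rle_mult_inv_pos; lra.
(* The correction crit^3 / N^2 is of order sqrt(L^3 / N), hence harmless. *)
have h2 : crit * crit / (2 * (N - crit)) <= crit * crit / (2 * N) + crit * crit * crit / (N * N).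
  have -> : crit * crit / (2 * (N - crit)) =
    crit * crit / (2 * N) + crit * crit * crit / (N * N) * (N / (2 * (N - crit))).
    by field; lra.
  apply: Rplus_le_compat_l; rewrite -{2}(Rmult_1_r (_ / (N * N))).
  apply: Rmult_le_compat_l.
    apply: Rle_mult_inv_pos; last by apply: Rmult_lt_0_compat; lra.
    by apply: Rmult_le_pos; [apply: Rmult_le_pos|]; lra.
  apply: (Rmult_le_reg_r (2 * (N - crit))); first lra.
  have -> : N / (2 * (N - crit)) * (2 * (N - crit)) = N by field; lra.
  lra.
have h3 : crit * crit * crit / (N * N) <= 1.
  apply: (Rmult_le_reg_r (N * N)); first by apply: Rmult_lt_0_compat; lra.
  have -> : crit * crit * crit / (N * N) * (N * N) = crit * crit * crit by field; lra.
  have JL : 0 <= 4 * J * L * N.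
    by apply: Rmult_le_pos; [apply: Rmult_le_pos|]; lra.
  apply: (Rle_trans _ (4 * J * L * N * (2 * J * rt))).
    apply: Rmult_le_compat; try lra; [by apply: Rmult_le_pos; lra|exact: crit_sq_le|exact: crit_le].
  have -> : 4 * J * L * N * (2 * J * rt) = (8 * J ^ 2 * (L * rt)) * N by ring.
  rewrite Rmult_1_l; apply: Rmult_le_compat_r; first lra.
  apply: Rle_trans rt_small; apply: Rmult_le_compat_r.
    by apply: Rmult_le_pos; lra.
  have [p1 p2] := pow_J; lra.
have h4 : crit * crit / (2 * N) <= J * ((L + l) / 2) - J * c * l + J * (a ^ 2 / 2).
  rewrite crit_sq.
  have -> : N * (J * (L + 2 * a * l + a ^ 2 * (l * l / L))) / (2 * N) =
     J * ((L + 2 * a * l) / 2 + a ^ 2 / 2 * (l * l / L)) by field; lra.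
  have -> : J * ((L + l) / 2) - J * c * l + J * (a ^ 2 / 2) =
     J * ((L + 2 * a * l) / 2 + a ^ 2 / 2 * 1) by rewrite {2}aE; field.
  apply: Rmult_le_compat_l; first lra.
  have [_ ll] := l2L.
  have : a ^ 2 / 2 * (l * l / L) <= a ^ 2 / 2 * 1.
    by apply: Rmult_le_compat_l => //; have := pow2_ge_0 a; lra.
  lra.
have h5 : a ^ 2 / 2 + 1 + F + ln 400 <= c * l.
  have -> : a ^ 2 / 2 + 1 + F + ln 400 = c * ((a ^ 2 / 2 + 1 + F + ln 400) / c).
    by field; lra.
  by apply: Rmult_le_compat_l; first lra; have := rg_Bl rg; lra.
have h6 : J * (a ^ 2 / 2 + 1 + F + ln 400) <= J * (c * l) by apply: Rmult_le_compat_l; lra.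
have h7 : 1 * (1 + F) <= J * (1 + F) by apply: Rmult_le_compat_r; lra.
lra.
Qed.

End Lower.

Section Upper.
(** In use [Z] is (p - j) - (n - p) for the first p beyond the critical value, N - J is (p - j) + (n
    - p), and [d] is an even number within 2 of Z / 2. *)
Variables (c Z d : R).
Hypotheses (c0 : 0 < c) (aE : a = / 2 + c).
Hypotheses (YZ : crit - J <= Z) (ZY : Z <= crit + 2).
Hypotheses (B1 : 20 * J <= B) (B2 : (4 + ln (16 * J)) / c <= B).
Hypotheses (dZ : 2 * d <= Z) (Zd : Z / 2 - 2 <= d).

Lemma upper_Z : 2 * J <= Z /\ 4 <= Z /\ Z <= 4 * J * rt /\ Z <= N / 4.
Proof.
have := crit_ge; have := rg_BL rg; have := rg_Lrt rg; have := crit_le; have := crit_small.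
lra.
Qed.

(** Because d is within 2 of Z / 2, d (Z + 1 - d) >= Z^2 / 4 - 4, and the exponent exceeds J (L + l)
    / 2 by the margin J c l up to a constant. In 16 J rt, one factor 4 comes from p - j >= N / 4,
    and 4 J rt bounds Z. *)
Lemma upper_exponent : J * ln (16 * J * rt) <
  2 / (N - J) * (d * (Z + 1 - d)) - 4 * d * Z ^ 2 / (N - J) ^ 2.
Proof.
have N1 := rg_N rg; have L1 := rg_L rg; have r0 := rg_rt rg; have l1 := rg_l rg.
have [Z1 [Z2 [Z3 Z4]]] := upper_Z.
set s := N - J; have s1 : N / 2 <= s by rewrite /s; lra.
have sN : s <= N by rewrite /s; lra.
have h1 : 2 / N * (Z ^ 2 / 4 - 4) <= 2 / s * (d * (Z + 1 - d)).
  apply: Rmult_le_compat.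
  - by apply: Rle_mult_inv_pos; lra.
  - have : 4 ^ 2 <= Z ^ 2 by apply: pow_incr; lra.
    lra.
  - by apply: Rmult_le_compat_l; [lra|apply: Rinv_le_contravar; lra].
  have : (Z / 2 - d) ^ 2 <= 2 ^ 2 by apply: pow_incr; lra.
  lra.
have h2 : 4 * d * Z ^ 2 / s ^ 2 <= 8 * Z ^ 3 / N ^ 2.
  have -> : 8 * Z ^ 3 / N ^ 2 = 2 * Z * Z ^ 2 * (/ (N / 2) ^ 2) by field; lra.
  have z2 : 0 <= Z ^ 2 by apply: pow2_ge_0.
  apply: Rmult_le_compat.
  - by apply: Rmult_le_pos; lra.
  - by left; apply: Rinv_0_lt_compat; apply: pow_lt; lra.
  - by apply: Rmult_le_compat_r; lra.
  - by apply: Rinv_le_contravar; [apply: pow_lt; lra|apply: pow_incr; lra].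
(* This is where the value of [tau] comes from: 8 (4 J rt)^3 = 512 J^3 N L rt. *)
have h3 : 8 * Z ^ 3 / N ^ 2 <= 1.
  apply: (Rmult_le_reg_r (N ^ 2)); first by apply: pow_lt; lra.
  have -> : 8 * Z ^ 3 / N ^ 2 * N ^ 2 = 8 * Z ^ 3 by field; lra.
  apply: (Rle_trans _ (8 * (4 * J * rt) ^ 3)).
    by apply: Rmult_le_compat_l; [lra|apply: pow_incr; lra].
  have -> : 8 * (4 * J * rt) ^ 3 = 512 * J ^ 3 * ((rt * rt) * rt) by ring.
  rewrite (rg_rt2 rg).
  have -> : 512 * J ^ 3 * (N * L * rt) = 512 * J ^ 3 * (L * rt) * N by ring.
  have -> : 1 * N ^ 2 = N * N by ring.
  by apply: Rmult_le_compat_r; [lra|exact: rt_small].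
have h4 : 2 / N * (Z ^ 2 / 4 - 4) >= crit * crit / (2 * N) - 2.
  have cs := crit_small; have cJ : J <= crit.
    by have := crit_ge; have := rg_BL rg; have := rg_Lrt rg; lra.
  have : (crit - J) ^ 2 <= Z ^ 2 by apply: pow_incr; lra.
  have J2 : 0 <= J ^ 2 by apply: pow2_ge_0.
  move=> h.
  have : 2 * J * crit <= N.
    have := rt_small; have := crit_le; have := rt_le_Lrt; have [p1 p2] := pow_J => q1 q2 q3.
    have : 2 * J * crit <= 2 * J * (2 * J * rt) by apply: Rmult_le_compat_l; lra.
    have : J ^ 2 * rt <= J ^ 3 * (L * rt) by apply: Rmult_le_compat; lra.
    lra.
  move=> h'.
  have N16 : 16 <= N by have := rg_BL rg; have := rg_Lrt rg; have := crit_ge; lra.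
  apply: Rle_ge; apply: (Rmult_le_reg_r (2 * N)); first lra.
  have -> : (crit * crit / (2 * N) - 2) * (2 * N) = crit * crit - 4 * N by field; lra.
  have -> : 2 / N * (Z ^ 2 / 4 - 4) * (2 * N) = Z ^ 2 - 16 by field; lra.
  lra.
have h5 : crit * crit / (2 * N) >= J * ((L + l) / 2) + J * c * l.
  rewrite crit_sq.
  have -> : N * (J * (L + 2 * a * l + a ^ 2 * (l * l / L))) / (2 * N) =
     J * ((L + 2 * a * l) / 2 + a ^ 2 / 2 * (l * l / L)) by field; lra.
  have -> : J * ((L + l) / 2) + J * c * l = J * ((L + 2 * a * l) / 2) by rewrite aE; field.
  apply: Rle_ge; apply: Rmult_le_compat_l; first lra.
  have [ll _] := l2L.
  have : 0 <= a ^ 2 / 2 * (l * l / L) by apply: Rmult_le_pos => //; have := pow2_ge_0 a; lra.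
  lra.
have h6 : 4 + ln (16 * J) <= c * l.
  have -> : 4 + ln (16 * J) = c * ((4 + ln (16 * J)) / c) by field; lra.
  by apply: Rmult_le_compat_l; first lra; have := rg_Bl rg; lra.
have h7 : J * (4 + ln (16 * J)) <= J * (c * l) by apply: Rmult_le_compat_l; lra.
rewrite ln_mult; try lra.
rewrite (rg_lnrt rg); lra.
Qed.

End Upper.

End CriticalInequalities.

(** * From exponents to bounds on the depth *)

Section DepthBounds.
Local Open Scope R_scope.

Definition main_term (j n : nat) : R :=
  INR n / 2 + / 2 * sqrt (INR j * INR n * ln (INR n))
  + / 4 * sqrt (INR j * INR n / ln (INR n)) * ln (ln (INR n)).

Definition error_term (n : nat) : R := sqrt (INR n / ln (INR n)) * ln (ln (INR n)).

Lemma error_termE tau A B n :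
  regime tau A B (INR n) (ln (INR n)) (ln (ln (INR n))) (sqrt (INR n * ln (INR n))) ->
  error_term n = sqrt (INR n * ln (INR n)) / ln (INR n) * ln (ln (INR n)).
Proof.
move=> rg; have L1 := rg_L rg; have N1 := rg_N rg; have r0 := rg_rt rg.
rewrite /error_term; congr (_ * _).
rewrite -[RHS]sqrt_square; last by apply: Rle_mult_inv_pos; lra.
congr sqrt; move: (rg_rt2 rg); set rt := sqrt _ => h.
transitivity (rt * rt / (ln (INR n) * ln (INR n))); last by field; lra.
by rewrite h; field; lra.
Qed.

(** The coefficient 1/4 of the third term of the expansion becomes a = 1/2, and adding x error terms
    shifts a by 2x / sqrt j. *)
Lemma main_termE tau A B j n x : (0 < j)%N ->
  regime tau A B (INR n) (ln (INR n)) (ln (ln (INR n))) (sqrt (INR n * ln (INR n))) ->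
  2 * (main_term j n + x * error_term n) - INR n =
  crit (INR j) (ln (INR n)) (ln (ln (INR n))) (sqrt (INR n * ln (INR n)))
       (/ 2 + 2 * x / sqrt (INR j)).
Proof.
move=> /ltP/lt_INR j0 rg; have L1 := rg_L rg; have N1 := rg_N rg; have r0 := rg_rt rg.
have s0 : 0 < sqrt (INR j) by apply: sqrt_lt_R0.
rewrite /main_term /crit (error_termE rg).
have -> : sqrt (INR j * INR n * ln (INR n)) = sqrt (INR j) * sqrt (INR n * ln (INR n)).
  by rewrite Rmult_assoc sqrt_mult //; [left|left; apply: Rmult_lt_0_compat; lra].
have -> : sqrt (INR j * INR n / ln (INR n)) = 
    sqrt (INR j) * (sqrt (INR n * ln (INR n)) / ln (INR n)).
  have := error_termE rg; rewrite /error_term => /Rmult_eq_reg_r <-; last first.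
    by have := rg_l rg; lra.
  rewrite -sqrt_mult; [by congr sqrt; field; lra|by left|].
  by apply: Rle_mult_inv_pos; lra.
by field; lra.
Qed.

Lemma exp_pow_ln y j : 0 < y -> exp (INR j * ln y) = y ^ j.
Proof. by move=> y0; rewrite -Rpower_pow. Qed.

Lemma exp_le_bin U F y j d : F = ln (INR (j`!)%N) -> 0 < y <= INR d ->
  U + F <= INR j * ln y -> exp U <= INR 'C(j + d, j).
Proof.
move=> FE [y0 yd] h.
have f0 : 0 < INR (j`!)%N by apply: (proj1 (INR_ltn 0 _)); apply: fact_gt0.
apply: (Rmult_le_reg_r (INR (j`!)%N)) => //.
have <- : exp F = INR (j`!)%N by rewrite FE exp_ln.
rewrite -exp_plus; apply: Rle_trans (exp_mono h) _.
rewrite exp_pow_ln // FE exp_ln // addnC.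
apply: Rle_trans (INR_bin_fact_ge d j); apply: pow_incr; lra.
Qed.

Lemma two_le_bin j d : (0 < j)%N -> (0 < d)%N -> 2 <= INR 'C(j + d, j).
Proof.
move=> j0 d0; have -> : 2 = INR 2 by rewrite /=; lra.
apply: (proj1 (INR_leq _ _)).
have h : ('C(j + 1, j) <= 'C(j + d, j))%N by apply: leq_bin2l; rewrite leq_add2l.
by apply: leq_trans h; rewrite addn1 binSn.
Qed.

Lemma depth_lower_bound j eps : (0 < j)%N -> 0 < eps -> eventually (fun n =>
  exists2 p, admissible n j p & main_term j n - eps * error_term n - 1 <= INR p).
Proof.
move=> j0 eps0; set J := INR j.
have J1 : 1 <= J by exact: (proj1 (INR_leq 1 _) j0).
have [[sJ1 sJ2] sJ3] := sqrt_J J1.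
pose c := 2 * eps / sqrt J; pose a := / 2 - c.
have c0 : 0 < c by apply: Rdiv_lt_0_compat; lra.
pose F := ln (INR (j`!)%N).
have F0 : 0 <= F.
  rewrite -ln_1; apply: ln_mono; first lra.
  by apply: (proj1 (INR_leq 1 _)); apply: fact_gt0.
pose B5 := (a ^ 2 / 2 + 1 + F + ln 400) / c.
pose B := 11 * J + 7 * F + 4 * (J + 1) + Rmax 0 B5.
have M0 := Rmax_l 0 B5; have M1 := Rmax_r 0 B5.
pose A := 2 * Rabs a + 6; have A0 : 0 < A by have := Rabs_pos a; rewrite /A; lra.
have J3 : 0 < 512 * J ^ 3 by apply: Rmult_lt_0_compat; [lra|apply: pow_lt; lra].
apply: eventually_imp (eventually_regime B (Rinv_0_lt_compat _ J3) A0) => n rg.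
have := main_termE (- eps) j0 rg.
have -> : / 2 + 2 * - eps / sqrt (INR j) = a by rewrite /a /c /J; field; rewrite -/J; lra.
move: rg; set N := INR n; set L := ln N; set l := ln L; set rt := sqrt _ => rg.
rewrite -/J; set Y := crit _ _ _ _ _ => mE.
have aA : 2 * Rabs a <= A by rewrite /A; lra.
have Ys : 64 * Y <= N := crit_small J1 rg erefl aA.
have Yg : rt / 2 <= Y := crit_ge J1 rg aA.
have r0 := rg_rt rg; have N1 := rg_N rg; have BL := rg_BL rg; have Lrt := rg_Lrt rg.
(* Rounding down costs the additive 1 of the statement. *)
have [p [p1 p2]] : exists p, INR p <= (N + Y) / 2 < INR p + 1 by apply: nat_floor; lra.
exists p; last by lra.
pose X := 2 * INR p - N - J + 1.
have XY : X <= Y by rewrite /X; lra.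
have YX : Y - (J + 1) <= X by rewrite /X; lra.
have pn : (p <= n)%N by apply: (proj2 (INR_leq _ _)); rewrite -/N; lra.
have eE : INR (n - p) = N - INR p by rewrite INR_subn.
have eY : (N - Y) / 2 <= INR (n - p) by rewrite eE; lra.
have B1 : 11 * J <= B by rewrite /B; lra.
have B2 : 7 * F <= B by rewrite /B; lra.
have B3 : 4 * (J + 1) <= B by rewrite /B; lra.
have B4 : B5 <= B by rewrite /B; lra.
have X0 : rt / 4 <= X := lower_X J1 rg aA YX B3.
have e0 : 3 / 8 * N <= INR (n - p) := lower_e J1 rg erefl aA eY.
have A6 : 6 <= A by have := Rabs_pos a; rewrite /A; lra.
have [v0 _] := lower_v rg A6.
have small := lower_small J1 rg erefl aA XY YX eY B1 B3.
have medium := lower_medium J1 rg erefl aA A6 XY YX eY B1 B2 B3.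
have large := lower_large J1 rg erefl aA F0 c0 erefl XY YX eY B3 B4.
have NJ : J <= N by have := rt_small J1 rg erefl; have := rt_le_Lrt rg; lra.
have jp : (j <= p)%N.
  suff : (j < p.+1)%N by [].
  by apply: (proj2 (INR_ltn _ _)); rewrite S_INR -/J; move: X0; rewrite /X; lra.
have qE : INR (p - j) = INR p - J by rewrite INR_subn.
have eq : (n - p <= p - j)%N.
  by apply: (proj2 (INR_leq _ _)); rewrite eE qE; move: X0; rewrite /X; lra.
have e1 : (0 < n - p)%N by apply: (proj2 (INR_ltn _ _)); rewrite /=; lra.
apply: admissible_of_bin => // d d0; apply: (proj2 (INR_leq _ _)); rewrite INR_muln.
have dpos : 0 <= INR d by apply: pos_INR.
have qeX : INR (p - j) - INR (n - p) + 1 = X by rewrite qE eE /X; ring.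
have lin U : X / INR (n - p) * INR d <= U -> exp U <= INR 'C(j + d, j) ->
    INR 'C(p - j, d) <= INR 'C(j + d, j) * INR 'C(n - p + d.-1, d).
  move=> hU hE; apply: Rle_trans (bin_ratio_le_linear e1 d eq) _.
  apply: Rmult_le_compat_r; first exact: pos_INR.
  apply: Rle_trans hE; apply: exp_mono; apply: Rle_trans hU.
  apply: Rmult_le_compat_r => //; apply: Rmult_le_compat_r; last lra.
  by left; apply: Rinv_0_lt_compat; lra.
(* Three ranges of [d], in which C(j+d,j) is bounded below by 2, by v^j / j! with v = N / (L rt),
   and by (X / 100)^j / j!. *)
case: (Rle_lt_dec (INR d) (N / (L * rt))) => dv.
  apply: (lin (/ 2)); first by apply: small; lra.
  apply: Rle_trans (two_le_bin j0 d0).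
  have := exp_ge (- / 2); rewrite exp_Ropp (_ : 1 + - / 2 = / 2); last lra.
  have z1 : 0 < / 2 by lra.
  by move/(Rinv_le_contravar _ _ z1); rewrite !Rinv_inv.
case: (Rle_lt_dec (INR d) (X / 100)) => dX.
  apply: (lin (X / INR (n - p) * INR d)); first lra.
  apply: (@exp_le_bin _ F (N / (L * rt))) => //; first lra.
  by apply: medium; lra.
apply: Rle_trans (bin_ratio_le _ e1 d) _.
apply: Rmult_le_compat_r; first exact: pos_INR.
rewrite qeX; apply: (@exp_le_bin _ F (X / 100)) => //; lra.
Qed.

Lemma depth_upper_bound j eps : (0 < j)%N -> 0 < eps -> eventually (fun n =>
  forall p, admissible n j p -> INR p <= main_term j n + eps * error_term n + 1).
Proof.
move=> j0 eps0; set J := INR j.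
have J1 : 1 <= J by exact: (proj1 (INR_leq 1 _) j0).
have [[sJ1 sJ2] sJ3] := sqrt_J J1.
pose c := 2 * eps / sqrt J; pose a := / 2 + c.
have c0 : 0 < c by apply: Rdiv_lt_0_compat; lra.
pose B5 := (4 + ln (16 * J)) / c.
pose B := 20 * J + Rmax 0 B5.
have M0 := Rmax_l 0 B5; have M1 := Rmax_r 0 B5.
pose A := 2 * Rabs a + 6; have A0 : 0 < A by have := Rabs_pos a; rewrite /A; lra.
have J3 : 0 < 512 * J ^ 3 by apply: Rmult_lt_0_compat; [lra|apply: pow_lt; lra].
apply: eventually_imp (eventually_regime B (Rinv_0_lt_compat _ J3) A0) => n rg.
have := main_termE eps j0 rg; rewrite -/J -/c -/a.
move: rg; set N := INR n; set L := ln N; set l := ln L; set rt := sqrt _ => rg.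
set Y := crit _ _ _ _ _ => mE.
have aA : 2 * Rabs a <= A by rewrite /A; lra.
have Ys : 64 * Y <= N := crit_small J1 rg erefl aA.
have Yg : rt / 2 <= Y := crit_ge J1 rg aA.
have r0 := rg_rt rg; have N1 := rg_N rg; have BL := rg_BL rg; have Lrt := rg_Lrt rg.
move=> p' ap'; apply: Rnot_lt_le => hp'.
have [p [p1 p2]] : exists p, INR p <= (N + Y) / 2 < INR p + 1 by apply: nat_floor; lra.
(* By monotonicity it suffices to refute the first integer above (N + Y) / 2, for which 2p - N
   exceeds Y by at most 2. *)
have {hp' ap'} : admissible n j p.+1.
  by apply: admissible_le ap'; apply: (proj2 (INR_leq _ _)); rewrite S_INR; lra.
rewrite -S_INR in p2; have {}p1 : INR p.+1 <= (N + Y) / 2 + 1 by rewrite S_INR; lra.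
move: p.+1 p1 p2 => {}p p1 p2 ap.
have [pn _] := ap.
pose Z := 2 * INR p - N - J.
have YZ : Y - J <= Z by rewrite /Z; lra.
have ZY : Z <= Y + 2 by rewrite /Z; lra.
have B1 : 20 * J <= B by rewrite /B; lra.
have B2 : B5 <= B by rewrite /B; lra.
have [Z1 [Z2 [Z3 Z4]]] := upper_Z J1 rg erefl aA YZ ZY B1.
(* The peak is near Z / 2; doubling the floor of Z / 4 gives the even d that [admissible_bin]
   requires. *)
have [m [m1 m2]] : exists m, INR m <= Z / 4 < INR m + 1 by apply: nat_floor; lra.
have dE : INR m.*2 = 2 * INR m by rewrite -muln2 INR_muln /=; ring.
set d := m.*2 in dE *.
have dZ : 2 * INR d <= Z by rewrite dE; lra.
have Zd : Z / 2 - 2 <= INR d by rewrite dE; lra.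
have V := upper_exponent J1 rg erefl aA c0 erefl YZ ZY B1 B2 dZ Zd.
have NJ : 512 * J <= N.
  have := rt_small J1 rg erefl; have := rt_le_Lrt rg; have [q1 q2] := pow_J J1.
  move=> h1 h2; have : J ^ 3 * 1 <= J ^ 3 * (L * rt) by apply: Rmult_le_compat_l; lra.
  lra.
have jp : (j <= p)%N by apply: (proj2 (INR_leq _ _)); rewrite -/J; lra.
have eE : INR (n - p) = N - INR p by rewrite INR_subn.
have qE : INR (p - j) = INR p - J by rewrite INR_subn.
have eq : (n - p <= p - j)%N.
  by apply: (proj2 (INR_leq _ _)); rewrite eE qE; move: Z2; rewrite /Z; lra.
have e1 : (0 < n - p)%N by apply: (proj2 (INR_ltn _ _)); rewrite eE /=; lra.
have d0 : (0 < d)%N.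
  rewrite /d double_gt0; apply: (proj2 (INR_ltn _ _)); rewrite /=; lra.
have od : ~~ odd d by rewrite /d odd_double.
have Ce : 0 < INR 'C(n - p + d.-1, d).
  apply: (proj1 (INR_ltn 0 _)); rewrite bin_gt0.
  by rewrite -{1}(prednK d0) -add1n leq_add2r.
have := admissible_bin ap d0 od; move/INR_leq; rewrite !INR_muln => hb.
have hge := bin_ratio_ge e1 (d := d) eq.
have qeZ : INR (p - j) - INR (n - p) = Z by rewrite qE eE /Z; ring.
have qe : INR (p - j) + INR (n - p) = N - J by rewrite qE eE; ring.
rewrite qeZ qe in hge.
have {}hge := hge ltac:(lra).
set E := exp _ in hge.
have EV : (16 * J * rt) ^ j < E.
  rewrite -exp_pow_ln; last by apply: Rmult_lt_0_compat; lra.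
  exact: exp_increasing.
have f0 : 0 < INR (j`!)%N by apply: (proj1 (INR_ltn 0 _)); apply: fact_gt0.
have f1 : 1 <= INR (j`!)%N by apply: (proj1 (INR_leq 1 _)); apply: fact_gt0.
have E0 : 0 < E by apply: exp_pos.
have h1 : INR 'C(p, j) * E <= INR 'C(n, j) * INR 'C(j + d, j).
  apply: (Rmult_le_reg_r (INR 'C(n - p + d.-1, d))) => //; apply: Rle_trans hb.
  rewrite Rmult_assoc; apply: Rmult_le_compat_l => //; exact: pos_INR.
have h2 : (N / 4) ^ j <= INR 'C(p, j) * INR (j`!)%N.
  have := INR_bin_fact_ge (p - j) j; rewrite subnK // qE => h.
  by apply: Rle_trans h; apply: pow_incr; lra.
have h3 := INR_bin_fact_le n j.
have h4 : INR 'C(j + d, j) <= Z ^ j.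
  have := INR_bin_fact_le (j + d) j => h.
  apply: (Rle_trans _ (INR 'C(j + d, j) * INR (j`!)%N)).
    rewrite -{1}(Rmult_1_r (INR _)); apply: Rmult_le_compat_l => //; exact: pos_INR.
  apply: Rle_trans h _; apply: pow_incr; split; first exact: pos_INR.
  by rewrite INR_addn -/J; lra.
have h5 : (N / 4) ^ j * E <= N ^ j * Z ^ j.
  apply: (Rle_trans _ (INR 'C(p, j) * INR (j`!)%N * E)).
    by apply: Rmult_le_compat_r; lra.
  have -> : INR 'C(p, j) * INR (j`!)%N * E = INR 'C(p, j) * E * INR (j`!)%N by ring.
  apply: (Rle_trans _ (INR 'C(n, j) * INR 'C(j + d, j) * INR (j`!)%N)).
    by apply: Rmult_le_compat_r; lra.
  have -> : INR 'C(n, j) * INR 'C(j + d, j) * INR (j`!)%N =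
    INR 'C(n, j) * INR (j`!)%N * INR 'C(j + d, j) by ring.
  apply: Rmult_le_compat => //; last exact: pos_INR.
  by apply: Rmult_le_pos; [exact: pos_INR|lra].
(* This contradicts Z <= 4 J rt, since (N / 4) (16 J rt) = N (4 J rt). *)
have h6 : (N / 4) ^ j * (16 * J * rt) ^ j < N ^ j * Z ^ j.
  by apply: Rlt_le_trans h5; apply: Rmult_lt_compat_l => //; apply: pow_lt; lra.
move: h6; rewrite -!Rpow_mult_distr; apply: Rle_not_lt; apply: pow_incr; split.
  by apply: Rmult_le_pos; lra.
have : N * Z <= N * (4 * J * rt) by apply: Rmult_le_compat_l; lra.
lra.
Qed.

(* For k = 1 the bound C(p, d) <= C(n - p + d - 1, d) holds for all even d
   iff it holds for d = 2, that is iff 2 p <= n + 1. *)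
Lemma depth_le_half n p : admissible n 0 p -> INR p <= INR n / 2 + 1.
Proof.
move=> ap; have [pn _] := ap.
have := @admissible_bin n 0 p 2 ap isT isT; rewrite subn0 !bin0 !mul1n /= => h.
have : (p <= n - p + 1)%N.
  rewrite leqNgt; apply/negP => lt.
  have : ('C((n - p + 1).+1, 2) <= 'C(p, 2))%N by apply: leq_bin2l.
  by rewrite binS bin1; lia.
move/INR_leq; rewrite INR_addn INR_subn //= => h'; lra.
Qed.

(** For j = 0 the criterion is C(p,d) <= C(n-p+d-1,d), which holds by monotonicity when p <= n -
    p. *)
Lemma admissible_half n : exists2 p, admissible n 0 p & INR n / 2 - 1 <= INR p.
Proof.
have h2 : (n./2 <= n - n./2)%N by have := odd_double_half n; lia.
exists n./2.
  apply: admissible_of_bin => [|d d0]; first by have := odd_double_half n; lia.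
  by rewrite subn0 bin0 mul1n; apply: leq_bin2l; lia.
have : (n <= n./2 + n./2 + 1)%N by have := odd_double_half n; case: (odd n); lia.
by move/INR_leq; rewrite !INR_addn /=; lra.
Qed.

Lemma depth_asymptotics j (h : nat -> nat) :
  (forall n, (j < n)%N -> admissible n j (h n)) ->
  (forall n p, (j < n)%N -> admissible n j p -> (p <= h n)%N) ->
  forall eps, 0 < eps -> eventually (fun n =>
    Rabs (INR (h n) - main_term j n) <= eps * error_term n).
Proof.
move=> ha hmax eps eps0.
(* The error term tends to infinity, as rt / L >= L; half of [eps] times it absorbs the additive 1
   of the two bounds. *)
have err : eventually (fun n => 2 <= eps * error_term n).
  apply: eventually_imp (eventually_regime (2 / eps) Rlt_0_1 Rlt_0_1) => n rg.
  rewrite (error_termE rg).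
  have L1 := rg_L rg; have l1 := rg_l rg; have r0 := rg_rt rg; have N1 := rg_N rg.
  have BL := rg_BL rg; have t := rg_tau rg; have r2 := rg_rt2 rg.
  set rt := sqrt _ in r0 t r2 *; set L := ln (INR n) in L1 BL t r2 l1 *.
  have h1 : L * L <= rt.
    apply: (Rmult_le_reg_r rt) => //; rewrite r2.
    have : L * (L * rt) <= L * (1 * INR n) by apply: Rmult_le_compat_l; lra.
    lra.
  have h2 : L <= rt / L.
    apply: (Rmult_le_reg_r L); first lra.
    by have -> : rt / L * L = rt by field; lra.
  have h3 : 2 / eps * 1 <= rt / L * ln L.
    by apply: Rmult_le_compat; try lra; left; apply: Rdiv_lt_0_compat; lra.
  have -> : 2 = eps * (2 / eps * 1) by field; lra.
  by apply: Rmult_le_compat_l; lra.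
case: (posnP j) ha hmax => [-> ha hmax|j0 ha hmax].
  apply: eventually_imp (eventually_and err (eventually_geq 1)) => n [en n1].
  have [p ap lp] := admissible_half n.
  have hp := proj1 (INR_leq _ _) (hmax _ _ n1 ap).
  have up := depth_le_half (ha _ n1).
  have -> : main_term 0 n = INR n / 2.
    by rewrite /main_term /Rdiv !Rmult_0_l sqrt_0; ring.
  by apply: Rabs_le; lra.
have e2 : 0 < eps / 2 by lra.
have lo := depth_lower_bound j0 e2; have up := depth_upper_bound j0 e2.
apply: eventually_imp (eventually_and (eventually_and lo up)
  (eventually_and err (eventually_geq j.+1))) => n [[[p ap lp] up'] [en jn]].
have hp := proj1 (INR_leq _ _) (hmax _ _ jn ap).
have hu := up' _ (ha _ jn).
by apply: Rabs_le; lra.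
Qed.

End DepthBounds.

Open Scope R_scope.

Theorem theorem4p1 (K : fieldType) (k : nat) (hk : (0 < k)%N) :
  exists hd : nat -> nat,
    (forall n : nat, (k <= n)%N -> is_Hdepth1 K n k (hd n)) /\
    forall eps : R, 0 < eps ->
      exists N : nat, forall n : nat, (N <= n)%N ->
        Rabs (INR (hd n)
              - (INR n / 2
                 + / 2 * sqrt (INR (k - 1) * INR n * ln (INR n))
                 + / 4 * sqrt (INR (k - 1) * INR n / ln (INR n))
                       * ln (ln (INR n))))
        <= eps * (sqrt (INR n / ln (INR n)) * ln (ln (INR n))).
Proof.
case: k hk => // j _.
have /choice [hd Hhd] n : exists h, (j < n)%N ->
  [/\ is_Hdepth1 K n j.+1 h, admissible n j h & forall p, admissible n j p -> (p <= h)%N].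
  case: (ltnP j n) => [/(Hdepth1_admissible K)[h Hh]|]; first by exists h.
  (* A filler value for n < k, where nothing is claimed. *)
  by exists 0%N.
exists hd; split; first by move=> n /Hhd [].
rewrite subn1 /=; apply: depth_asymptotics; first by move=> n /Hhd [].
by move=> n p /Hhd [_ _]; apply.
Qed.
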